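(* Let $M=M\big((p_i)_{i=1}^L,(r_i)_{i=1}^L,(M_i)_{i=1}^L,\lambda\big)$ be a simulated tempering Markov chain on $[L]\times\mathcal X$ with stationary distribution $P$, and let $\mathcal X^0\subseteq\mathcal X$ be measurable. Suppose: (1) For each $i\in[L]$, $p_i(x)=\sum_{j=1}^{n} w_{(i,j)}p_{(i,j)}(x)$, where the $p_{(i,j)}$ are probability densities on $\mathcal X$ (with distributions $P_{(i,j)}$), $w_{(i,j)}\ge 0$ and $\sum_{j=1}^n w_{(i,j)}=1$; and $P_{(i,j)}(\mathcal X^0)>0$ for all $i,j$. (2) For each $i\in[L]$, $j\in[n]$ there is a Markov chain $M_{(i,j)}$ on $\mathcal X$ with stationary density $p_{(i,j)}$ such that, for some constants $C_1,C_2>0$, for every $i$ and every $g_i\in\mathcal L^2(\mathcal X,P_i)$, $$\sum_{j=1}^{n} w_{(i,j)}\,\mathcal E_{(i,j),\mathcal X^0}(g_i,g_i)\le C_1\,\mathcal E_{i,\mathcal X^0}(g_i,g_i),$$ and, for every $j\in[n]$, $$\operatorname{Var}_{P_{(i,j)},\mathcal X^0}(g_i)\le C_2\,\mathcal E_{(i,j),\mathcal X^0}(g_i,g_i),$$ where $\mathcal E_{i,\mathcal X^0}$ and $\mathcal E_{(i,j),\mathcal X^0}$ are the $\mathcal X^0$-restricted Dirichlet forms of $M_i$ and $M_{(i,j)}$. (3) For some constant $C_3>0$, the projected chain $\overline M$ on $[L]\times[n]$, with stationary distribution $\overline P$ and Dirichlet form $\overline{\mathcal E}$, satisfies $\operatorname{Var}_{\overline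 P}(\overline g)\le C_3\,\overline{\mathcal E}(\overline g,\overline g)$ for every $\overline g:[L]\times[n]\to\mathbb R$. Define $\theta=P([L]\times\mathcal X^0)$ and $\phi=\min_{i,j}P_{(i,j)}(\mathcal X^0)$. Then $\mathrm{SpecGap}_{[L]\times\mathcal X^0}(M)\ge C_M^{-1}$, where $$C_M=\max\left\{3\theta C_3,\ \frac{\theta C_1C_2}{\phi(1-\lambda)}\big((2+\lambda)C_3+1\big)\right\}.$$
   Context: Restricted quantities. Let $K$ be a Markov kernel on $\Omega$ with stationary probability measure $\Pi$ and let $\Omega^0\subseteq\Omega$ be measurable with $\Pi(\Omega^0)>0$. Define $$\mathcal E_{\Omega^0}(g,g;\Pi,K)=\tfrac12\int_{\Omega^0}\int_{\Omega^0}[g(\omega')-g(\omega)]^2\,\Pi(d\omega)K(\omega,d\omega')$$ (the $\Omega^0$-restricted Dirichlet form of $K$), $$\operatorname{Var}_{\Pi,\Omega^0}(g)=\tfrac12\int_{\Omega^0}\int_{\Omega^0}[g(\omega')-g(\omega)]^2\,\Pi(d\omega)\Pi(d\omega'),$$ $$\mathrm{SpecGap}_{\Omega^0}(K)=\inf_{g}\mathcal E_{\Omega^0}(g,g;\Pi,K)/\operatorname{Var}_{\Pi,\Omega^0}(g),$$ the infimum being over $g\in\mathcal L^2(\Omega,\Pi)$ with $\operatorname{Var}_{\Pi,\Omega^0}(g)>0$. When $\Omega^0=\Omega$ the subscript is dropped; $\operatorname{Var}_\Pi$ is then the usual variance. Simulated tempering chain. $\mathcal X$ is a measurable space with a reference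 measure $dx$; uppercase letters denote distributions and the corresponding lowercase letters their densities. $L\ge2$ is an integer, $[L]=\{1,\dots,L\}$, $\lambda\in(0,1)$, $r_i>0$ with $\sum_{i=1}^L r_i=1$, and $M_i$ is a Markov kernel on $\mathcal X$ with stationary density $p_i$. From the state $(i,x)\in[L]\times\mathcal X$ the chain $M$ moves as follows: with probability $1-\lambda$, draw $x'\sim M_i(x,\cdot)$ and move to $(i,x')$; with probability $\lambda$, propose $i'=i+1$ or $i'=i-1$ with probability $1/2$ each and move to $(i',x)$ with probability $a((i,x),(i',x))=\min\{r_{i'}p_{i'}(x)/(r_ip_i(x)),1\}$, staying at $(i,x)$ otherwise (proposals $i'\notin[L]$ are always rejected). Its stationary distribution $P$ has density $p(i,x)=r_ip_i(x)$. Projected chain. $\overline M$ is the transition matrix on $[L]\times[n]$ given by - for $i'=i$, $j'\ne j$: $\overline M((i,j),(i,j'))=(1-\lambda)\int_{\mathcal X^0}\frac{p_{(i,j)}(x)}{P_{(i,j)}(\mathcal X^0)}\,p_i(j'\mid x)\,dx$, where $p_i(j\mid x)=w_{(i,j)}p_{(i,j)}(x)/p_i(x)$; - for $i'=i\pm1$, $j'=j$: $\overline M((i,j),(i',j))=\frac{\lambda}{2}\int_{\mathcal X^0}\frac{p_{(i,j)}(x)}{P_{(i,j)}(\mathcal X^0)}\,a((i,j,x),(i',j,x))\,dx$, where $a((i,j,x),(i',j',x))=\min\Big\{\frac{r_{i'}w_{(i',j')}p_{(i',j')}(x)}{r_iw_{(i,j)}p_{(i,j)}(x)},1\Big\}$;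 - all other off-diagonal entries are $0$, and diagonal entries make each row sum to $1$. Its stationary distribution is $\overline P(i,j)=r_iw_{(i,j)}P_{(i,j)}(\mathcal X^0)/P([L]\times\mathcal X^0)$, and $\overline{\mathcal E}$ is its Dirichlet form with respect to $\overline P$. Conventions for degenerate cases: an acceptance probability whose denominator vanishes is $1$; $p_i(j\mid x)=0$ if $p_i(x)=0$; $0\cdot\infty=0$. *)

(* Defs.v *)
From HB Require Import structures.
From mathcomp Require Import all_boot all_order all_algebra.
From mathcomp Require Import all_classical all_reals all_analysis.
From mathcomp Require Import measurable_realfun.
From mathcomp Require Import ring.

Set Implicit Arguments.
Unset Strict Implicit.
Unset Printing Implicit Defensive.

Import Order.TTheory GRing.Theory Num.Theory.
Import numFieldNormedType.Exports.

Local Open Scope classical_set_scope.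
Local Open Scope ring_scope.

(* The levels [L] = {1, ..., L} are represented by 'I_k.+2 with L = k.+2 >= 2
   (measurable types are pointed, hence the successors), with the discrete
   sigma-algebra. *)
HB.instance Definition _ n := isPointed.Build 'I_n.+1 ord0.
HB.instance Definition _ n := @isMeasurable.Build default_measure_display
  'I_n.+1 discrete_measurable discrete_measurable0
  discrete_measurableC discrete_measurableU.

Section restricted_quantities.
Local Open Scope ereal_scope.
Context d (T : measurableType d) (R : realType).

Definition stationary (Pi : {measure set T -> \bar R}) (K : R.-pker T ~> T) :=
  forall A, measurable A -> \int[Pi]_x K x A = Pi A.

Definition dirichlet_on (O : set T) (Pi : {measure set T -> \bar R})
    (K : R.-pker T ~> T) (g : T -> R) : \bar R :=
  2^-1%:E * \int[Pi]_(w in O) \int[K w]_(w' in O) ((g w' - g w) ^+ 2)%:E.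

Definition variance_on (O : set T) (Pi : {measure set T -> \bar R})
    (g : T -> R) : \bar R :=
  2^-1%:E * \int[Pi]_(w in O) \int[Pi]_(w' in O) ((g w' - g w) ^+ 2)%:E.

(* For g in L^2 the denominator is finite. *)
Definition spec_gap_on (O : set T) (Pi : {measure set T -> \bar R})
    (K : R.-pker T ~> T) : \bar R :=
  ereal_inf [set dirichlet_on O Pi K g / variance_on O Pi g |
    g in [set g : T -> R | g \in Lfun Pi 2%:E /\ 0 < variance_on O Pi g]].

End restricted_quantities.

Section finite_chain.
Context (R : realType) (S : finType).

Definition fin_dirichlet (pi : S -> R) (K : S -> S -> R) (g : S -> R) : R :=
  2^-1 * \sum_a \sum_b (g b - g a) ^+ 2 * pi a * K a b.

Definition fin_variance (pi : S -> R) (g : S -> R) : R :=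
  2^-1 * \sum_a \sum_b (g b - g a) ^+ 2 * pi a * pi b.

End finite_chain.

Section densities.
Local Open Scope ereal_scope.
Context d (X : measurableType d) (R : realType)
  (mu : {measure set X -> \bar R}).

Record density := Density {
  dens :> X -> R ;
  measurable_dens : measurable_fun [set: X] dens ;
  dens_ge0 : forall x, (0 <= dens x)%R ;
  integral_dens : \int[mu]_x (dens x)%:E = 1 }.

Definition law (p : density) (A : set X) : \bar R :=
  \int[mu]_(x in A) (p x)%:E.

Variable p : density.

Let law0 : law p set0 = 0.
Proof. exact: integral_set0. Qed.

Let law_ge0 A : 0 <= law p A.
Proof. by apply: integral_ge0 => x _; rewrite lee_fin dens_ge0. Qed.

Let law_sigma_additive : semi_sigma_additive (law p).
Proof.
move=> F mF tF mUF; rewrite /law ge0_integral_bigcup//.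
- by apply: is_cvg_ereal_nneg_natsum => n _; exact: law_ge0.
- by apply/measurable_EFinP; apply: measurable_funS (measurable_dens p).
- by move=> x _; rewrite lee_fin dens_ge0.
Qed.

HB.instance Definition _ := isMeasure.Build _ _ _ (law p)
  law0 law_ge0 law_sigma_additive.

Let law_setT : law p [set: X] = 1.
Proof. exact: integral_dens. Qed.

HB.instance Definition _ := Measure_isProbability.Build _ _ _ (law p) law_setT.

End densities.

Section acceptance.
Context (R : realType).

Definition accept (u v : R) : R := if v == 0 then 1 else Num.min (u / v) 1.

Lemma accept_ge0 u v : 0 <= u -> 0 <= v -> 0 <= accept u v.
Proof.
by move=> u0 v0; rewrite /accept; case: ifP => // _; rewrite le_min divr_ge0/=.
Qed.

Lemma accept_le1 u v : accept u v <= 1.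
Proof. by rewrite /accept; case: ifP => // _; rewrite ge_min lexx orbT. Qed.

Lemma measurable_accept d (X : measurableType d) (f g : X -> R) :
  measurable_fun [set: X] f -> measurable_fun [set: X] g ->
  (forall x, 0 <= g x) ->
  measurable_fun [set: X] (fun x => accept (f x) (g x)).
Proof.
move=> mf mg g0; rewrite /accept; apply: measurable_fun_ifT => //.
  exact: measurable_fun_eqr.
apply: measurable_minr => //; apply: measurable_funM => //.
under eq_fun do rewrite -powR_inv1//.
exact: (measurableT_comp (measurable_powR _)).
Qed.

End acceptance.

Section slices.
Context d (X : measurableType d) (R : realType) (n : nat).

Lemma measurable_fun_slices d' (Y : measurableType d') (f : 'I_n.+1 * X -> Y) :
  (forall i, measurable_fun [set: X] (fun x => f (i, x))) ->
  measurable_fun [set: 'I_n.+1 * X] f.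
Proof.
move=> mf _ B mB; rewrite setTI.
have -> : f @^-1` B = \bigcup_(i in [set: 'I_n.+1])
    ([set i] `*` ((fun x => f (i, x)) @^-1` B)).
  apply/seteqP; split => [[i x] /= fB|[i x] [j _] /= [-> //]].
  by exists i.
apply: fin_bigcup_measurable => [|i _]; first exact: finite_finset.
by apply: measurableX => //; rewrite -[X in measurable X]setTI; exact: mf.
Qed.

Local Open Scope ereal_scope.

Section at_level.
Variables (i : 'I_n.+1) (m : {measure set X -> \bar R}).

Definition at_level (A : set ('I_n.+1 * X)) : \bar R := m (xsection A i).

Let at_level0 : at_level set0 = 0.
Proof. by rewrite /at_level xsection0 measure0. Qed.

Let at_level_ge0 A : 0 <= at_level A.
Proof. exact: measure_ge0. Qed.

Let at_level_sigma_additive : semi_sigma_additive at_level.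
Proof.
move=> F mF tF mUF; rewrite /at_level xsection_bigcup.
apply: measure_semi_sigma_additive.
- by move=> k; exact: measurable_xsection.
- exact: trivIset_xsection.
- by apply: bigcup_measurable => k _; exact: measurable_xsection.
Qed.

HB.instance Definition _ := isMeasure.Build _ _ _ at_level
  at_level0 at_level_ge0 at_level_sigma_additive.

End at_level.

End slices.

Section simulated_tempering.
Local Open Scope ereal_scope.
Context d (X : measurableType d) (R : realType)
  (mu : {measure set X -> \bar R}) (k : nat).
Variables (p : 'I_k.+2 -> density mu) (r : 'I_k.+2 -> {posnum R})
  (M : 'I_k.+2 -> R.-pker X ~> X) (lambda : {itv R & `]0, 1[}).

Local Notation state := ('I_k.+2 * X)%type.

(* The measure with density (i, x) |-> r_i p_i(x) with respect to the product
   of the counting measure and mu. *)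
Definition st_law (A : set state) : \bar R :=
  \sum_(i < k.+2) \int[mu]_(x in xsection A i) ((r i)%:num * p i x)%:E.

Let st_law0 : st_law set0 = 0.
Proof. by rewrite /st_law big1// => i _; rewrite xsection0 integral_set0. Qed.

Let st_law_ge0 A : 0 <= st_law A.
Proof.
apply: sume_ge0 => i _; apply: integral_ge0 => x _.
by rewrite lee_fin mulr_ge0// dens_ge0.
Qed.

Lemma st_lawE A : measurable A ->
  st_law A = \sum_(i < k.+2) (r i)%:num%:E * law (p i) (xsection A i).
Proof.
move=> mA; apply: eq_bigr => i _; rewrite /law -ge0_integralZl_EFin//.
- exact: measurable_xsection.
- by move=> x _; rewrite lee_fin dens_ge0.
- by apply/measurable_EFinP; apply: measurable_funS (measurable_dens (p i)).
Qed.

Let st_law_sigma_additive : semi_sigma_additive st_law.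
Proof.
pose m j : {measure set state -> \bar R} := at_level (inord j : 'I_k.+2)
  (mscale (NngNum [ge0 of (r (inord j))%:num]) (law (p (inord j)))).
have mE A : measurable A -> st_law A = msum m k.+2 A.
  move=> mA; rewrite st_lawE//; apply: eq_bigr => i _.
  by rewrite /m /at_level/= inord_val.
move=> F mF tF mUF; rewrite mE//.
under eq_fun do under eq_bigr do rewrite mE//.
exact: measure_semi_sigma_additive.
Qed.

HB.instance Definition _ := isMeasure.Build _ _ _ st_law
  st_law0 st_law_ge0 st_law_sigma_additive.

(* true is the proposal i + 1, false the proposal i - 1; None stands for a
   proposal outside [L]. *)
Definition propose (b : bool) (i : 'I_k.+2) : option 'I_k.+2 :=
  if b then insub i.+1 else if val i is j.+1 then insub j else None.

Definition st_accept (z z' : state) : R :=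
  accept ((r z'.1)%:num * p z'.1 z'.2) ((r z.1)%:num * p z.1 z.2).

Definition st_swap (b : bool) (z : state) (A : set state) : \bar R :=
  if propose b z.1 is Some i' then
    let a := st_accept z (i', z.2) in
    a%:E * \d_(i', z.2) A + (1 - a)%:E * \d_z A
  else \d_z A.

Definition st_kernel (z : state) (A : set state) : \bar R :=
  (1 - lambda%:num)%:E * at_level z.1 (M z.1 z.2) A +
  lambda%:num%:E *
    (2^-1%:E * st_swap true z A + 2^-1%:E * st_swap false z A).

Let st_accept_ge0 z z' : (0 <= st_accept z z')%R.
Proof. by apply: accept_ge0; apply: mulr_ge0 => //; exact: dens_ge0. Qed.

Let st_accept_le1 z z' : (0 <= 1 - st_accept z z')%R.
Proof. by rewrite subr_ge0 accept_le1. Qed.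

Let st_swap_measure b z : exists m : {measure set state -> \bar R},
  st_swap b z = m.
Proof.
rewrite /st_swap; case: propose => [i'|]; last by exists \d_z.
exists (measure_add
  (mscale (NngNum (st_accept_ge0 z (i', z.2))) (\d_(i', z.2)))
  (mscale (NngNum (st_accept_le1 z (i', z.2))) (\d_z))).
by apply/funext => A; rewrite -[RHS]/(measure_add _ _ A) measure_addE.
Qed.

Let st_kernel_measure z : exists m : {measure set state -> \bar R},
  st_kernel z = m.
Proof.
have [m1 m1E] := st_swap_measure true z.
have [m2 m2E] := st_swap_measure false z.
exists (measure_add
  (mscale (NngNum [ge0 of (1 - lambda%:num)%R]) (at_level z.1 (M z.1 z.2)))
  (mscale (NngNum [ge0 of lambda%:num])
     (measure_add (mscale (2^-1)%:nng%R m1) (mscale (2^-1)%:nng%R m2)))).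
apply/funext => A; rewrite /st_kernel m1E m2E -[RHS]/(measure_add _ _ A) measure_addE.
by rewrite /mscale -[X in _ = _ + _ * X]/(measure_add _ _ A) measure_addE.
Qed.

Section st_kernel_is_measure.
Variable z : state.

Let st_kernel0 : st_kernel z set0 = 0.
Proof. by have [m ->] := st_kernel_measure z; exact: measure0. Qed.

Let st_kernel_ge0 A : 0 <= st_kernel z A.
Proof. by have [m ->] := st_kernel_measure z; exact: measure_ge0. Qed.

Let st_kernel_sigma_additive : semi_sigma_additive (st_kernel z).
Proof.
by have [m ->] := st_kernel_measure z; exact: measure_semi_sigma_additive.
Qed.

HB.instance Definition _ := isMeasure.Build _ _ _ (st_kernel z)
  st_kernel0 st_kernel_ge0 st_kernel_sigma_additive.

End st_kernel_is_measure.

Definition st_chain (z : state) : {measure set state -> \bar R} :=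
  st_kernel z.

Let measurable_rp i : measurable_fun [set: X] (fun x => (r i)%:num * p i x)%R.
Proof. by apply: measurable_funM => //; exact: measurable_dens. Qed.

Let measurable_st_swap b U : measurable U ->
  measurable_fun [set: state] (st_swap b ^~ U).
Proof.
move=> mU; apply: measurable_fun_slices => i; rewrite /st_swap/=.
case: propose => [i'|]; last first.
  by apply: measurableT_comp (measurable_fun_dirac mU) _.
have ma : measurable_fun [set: X] (fun x => st_accept (i, x) (i', x)).
  apply: measurable_accept; [exact: measurable_rp|exact: measurable_rp|move=> x].
  by apply: mulr_ge0 => //; exact: dens_ge0.
apply: emeasurable_funD; apply: emeasurable_funM.
- exact/measurable_EFinP.
- by apply: measurableT_comp (measurable_fun_dirac mU) _.
- by apply/measurable_EFinP; exact: measurable_funB.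
- by apply: measurableT_comp (measurable_fun_dirac mU) _.
Qed.

Let measurable_st_chain U : measurable U ->
  measurable_fun [set: state] (st_chain ^~ U).
Proof.
move=> mU; apply: emeasurable_funD; apply: measurable_funeM.
  apply: measurable_fun_slices => i /=.
  by apply: measurable_kernel; exact: measurable_xsection.
by apply: emeasurable_funD; apply: measurable_funeM; exact: measurable_st_swap.
Qed.

HB.instance Definition _ :=
  isKernel.Build _ _ _ _ _ st_chain measurable_st_chain.

Let st_swapT b z : st_swap b z [set: state] = 1.
Proof.
rewrite /st_swap; case: propose => [i'|]; last by rewrite diracT.
by rewrite !diracT !mule1 -EFinD addrC subrK.
Qed.

Let st_chain_prob z : st_chain z [set: state] = 1.
Proof.
rewrite /st_chain/= /st_kernel !st_swapT /at_level xsectionE preimage_setT prob_kernel.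
by rewrite !mule1 -!EFinD; congr EFin; field.
Qed.

HB.instance Definition _ :=
  Kernel_isProbability.Build _ _ _ _ _ st_chain st_chain_prob.

End simulated_tempering.

Section projected_chain.
Context d (X : measurableType d) (R : realType)
  (mu : {measure set X -> \bar R}) (k n : nat).
Variables (p : 'I_k.+2 -> density mu) (r : 'I_k.+2 -> {posnum R})
  (w : 'I_k.+2 -> 'I_n -> R) (pc : 'I_k.+2 -> 'I_n -> density mu)
  (lambda : {itv R & `]0, 1[}) (X0 : set X).

Local Notation index := ('I_k.+2 * 'I_n)%type.

(* p_i(j | x); since u / 0 = 0, it vanishes where p_i does. *)
Definition cond_comp (i : 'I_k.+2) (j : 'I_n) (x : X) : R :=
  w i j * pc i j x / p i x.

Definition comp_accept (a b : index) (x : X) : R :=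
  accept ((r b.1)%:num * w b.1 b.2 * pc b.1 b.2 x)
         ((r a.1)%:num * w a.1 a.2 * pc a.1 a.2 x).

Definition comp_mass (a : index) : R := fine (law (pc a.1 a.2) X0).

Definition proj_offdiag (a b : index) : R :=
  if (b.1 == a.1) && (b.2 != a.2) then
    (1 - lambda%:num) *
      \int[mu]_(x in X0) (pc a.1 a.2 x / comp_mass a * cond_comp a.1 b.2 x)
  else if ((b.1 == a.1.+1 :> nat) || (a.1 == b.1.+1 :> nat)) && (b.2 == a.2)
  then
    lambda%:num / 2 *
      \int[mu]_(x in X0) (pc a.1 a.2 x / comp_mass a * comp_accept a b x)
  else 0.

Definition proj_chain (a b : index) : R :=
  if b == a then 1 - \sum_(c | c != a) proj_offdiag a c else proj_offdiag a b.

Definition proj_law (a : index) : R :=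
  (r a.1)%:num * w a.1 a.2 * comp_mass a
    / fine (st_law p r ([set: 'I_k.+2] `*` X0)).

End projected_chain.

(* Main.v *)
(* Write P restricted to [L] x X0 as the mixture of the restricted components
   P_(i,j), with masses theta * Pbar(i,j), and let c(i,j) be the mean of
   g_i = g(i, .) under the (i,j)-th one.  Then the variance of g is the average
   of the variances inside the components plus the variance of c under Pbar.
   The inner variances are controlled by the local Poincare inequalities.  For
   c, the Poincare inequality of the projected chain leaves squares
   (c(b) - c(a))^2 weighted by an integral over X0.  Under that integral, a move
   within level i is bounded through one intermediate value,
   c(i,j) -> g_i(x) -> c(i,j'), which costs a factor 2, and a swap through two,
   c(i,j) -> g_i(x) -> g_i'(x) -> c(i',j), which costs a factor 3.  The middle
   step of the swaps sums to the swap part of the Dirichlet form of M, because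
   sum_j min(u_j, u'_j) <= min(sum_j u_j, sum_j u'_j), and the outer steps again
   give the inner variances, with coefficient 2(1 - lambda) + 3 lambda. *)

Require Import Defs.
From HB Require Import structures.
From mathcomp Require Import all_boot all_order all_algebra.
From mathcomp Require Import all_classical all_reals all_analysis.
From mathcomp Require Import measurable_realfun zify ring lra.

Set Implicit Arguments.
Unset Strict Implicit.
Unset Printing Implicit Defensive.

Import Order.TTheory GRing.Theory Num.Theory.
Import numFieldNormedType.Exports.

Local Open Scope classical_set_scope.
Local Open Scope ring_scope.

(** * Integrals against densities and tempering laws *)

Section density_integral.
Local Open Scope ereal_scope.
Context d (X : measurableType d) (R : realType)
  (mu : {measure set X -> \bar R}) (q : density mu).

Let q0 x : 0 <= (q x)%:E. Proof. by rewrite lee_fin dens_ge0. Qed.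

Lemma measurable_EFin_dens (D : set X) :
  measurable_fun D (fun x => (q x)%:E).
Proof.
apply: measurable_funTS; apply/measurable_EFinP; exact: measurable_dens.
Qed.

Let mq := @measurable_EFin_dens.

Import HBNNSimple.

(** A simple function is a finite combination of indicators of its fibres. On one fibre both sides
    reduce to the integral of [q] over the part of the fibre in [D], which is how [law] is
    defined. *)
Let integral_law_nnsfun (D : set X) (h : {nnsfun X >-> R}) : measurable D ->
  \int[law q]_(x in D) (h x)%:E = \int[mu]_(x in D) ((q x)%:E * (h x)%:E).
Proof.
move=> mD.
transitivity (\int[law q]_(x in D)
   (\sum_(y \in range h) (y * \1_(h @^-1` [set y]) x)%:E)).
  by apply: eq_integral => t tE; rewrite /= fimfunE -fsumEFin.
have mindic r :
    measurable_fun D (fun x => (r * \1_(h @^-1` [set r]) x)%:E).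
  by apply: (measurable_comp measurableT) => //; exact: measurable_funM.
rewrite ge0_integral_fsum//; last by move=> y x Dx; exact: nnfun_muleindic_ge0.
transitivity (\int[mu]_(x in D) (\sum_(y \in range h)
    (y * \1_(h @^-1` [set y]) x)%:E * (q x)%:E)); last first.
  under [LHS]eq_integral => x xE.
    rewrite -ge0_mule_fsuml => [|y]; last exact: nnfun_muleindic_ge0.
    rewrite fsumEFin // -(fimfunE _ x) muleC; over.
  by [].
rewrite [RHS]ge0_integral_fsum//; last 2 first.
  - by move=> y; apply: emeasurable_funM.
  - by move=> y x Dx; rewrite mule_ge0 ?q0// nnfun_muleindic_ge0.
apply: eq_fsbigr => r rhn.
under [LHS]eq_integral do rewrite EFinM.
rewrite [LHS]integralZl_indic_nnsfun => //.
under [RHS]eq_integral do rewrite EFinM -muleA.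
rewrite [RHS]ge0_integralZl//.
- congr (_ * _); rewrite integral_indic// setIC.
  rewrite [LHS](_ : _ = \int[mu]_(x in D `&` h @^-1` [set r]) (q x)%:E)//.
  rewrite integral_mkcondr.
  by apply: eq_integral => x xE; rewrite epatch_indic muleC.
- by apply: emeasurable_funM => //; exact/measurable_EFinP.
- by move=> x Dx; rewrite mule_ge0 ?q0// lee_fin.
- by move: rhn; rewrite inE => -[x _ <-]; rewrite lee_fin.
Qed.

(** Monotone convergence along [nnsfun_approx] on both sides: multiplication by the finite
    nonnegative [q x] preserves monotonicity and limits. *)
Lemma integral_law (D : set X) (f : X -> \bar R) : measurable D ->
  measurable_fun D f -> (forall x, D x -> 0 <= f x) ->
  \int[law q]_(x in D) f x = \int[mu]_(x in D) ((q x)%:E * f x).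
Proof.
move=> mD mf f0; pose h := nnsfun_approx mD mf.
have fE x : D x -> f x = lim ((EFin \o h n) x @[n --> \oo]).
  by move=> Dx; apply/esym/cvg_lim => //; exact: cvg_nnsfun_approx.
have qfE x : D x ->
    (q x)%:E * f x = lim ((q x)%:E * (EFin \o h n) x @[n --> \oo]).
  by move=> Dx; apply/esym/cvg_lim => //; apply: cvgeZl => //;
    exact: cvg_nnsfun_approx.
rewrite [LHS](eq_integral (fun x => lim ((EFin \o h n) x @[n --> \oo]))); last first.
  by move=> x /set_mem /fE ->.
rewrite [RHS](eq_integral
    (fun x => lim ((q x)%:E * (EFin \o h n) x @[n --> \oo]))); last first.
  by move=> x /set_mem /qfE ->.
rewrite !monotone_convergence//.
- by congr (limn _); apply/funext => n; exact: integral_law_nnsfun.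
- move=> n; apply: emeasurable_funM => //.
  by apply/measurable_funTS/measurable_EFinP.
- by move=> n x Dx; rewrite mule_ge0// lee_fin.
- move=> x Dx a b ab; rewrite lee_wpmul2l// lee_fin.
  exact/lefP/nd_nnsfun_approx.
- by move=> n; apply/measurable_funTS/measurable_EFinP.
- by move=> n x Dx; rewrite lee_fin.
- by move=> x Dx a b ab; rewrite lee_fin; exact/lefP/nd_nnsfun_approx.
Qed.

End density_integral.

(** * Integration level by level *)

Section tempering_integral.
Local Open Scope ereal_scope.
Context d (X : measurableType d) (R : realType).

(** [at_level i m] is the pushforward of [m] along x |-> (i, x). *)
Lemma integral_at_level n (i : 'I_n.+1) (m : {measure set X -> \bar R})
    (D : set ('I_n.+1 * X)) (f : 'I_n.+1 * X -> \bar R) :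
  measurable D -> measurable_fun [set: 'I_n.+1 * X] f -> (forall z, 0 <= f z) ->
  \int[at_level i m]_(z in D) f z = \int[m]_(x in xsection D i) f (i, x).
Proof.
move=> mD mf f0.
have mi : measurable_fun [set: X] (fun x => (i, x)) by exact: pair1_measurable.
rewrite (eq_measure_integral (pushforward m (fun x => (i, x)))); last first.
  by move=> A mA _; rewrite -[LHS]/(m (xsection A i)) xsectionE.
rewrite ge0_integral_pushforward//; last exact: measurable_funTS.
by rewrite xsectionE.
Qed.

Context (mu : {measure set X -> \bar R}) (k : nat).
Variables (p : 'I_k.+2 -> density mu) (r : 'I_k.+2 -> {posnum R}).

Lemma integral_st_law (D : set ('I_k.+2 * X)) (f : 'I_k.+2 * X -> \bar R) :
  measurable D -> measurable_fun [set: 'I_k.+2 * X] f -> (forall z, 0 <= f z) ->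
  \int[st_law p r]_(z in D) f z =
  \sum_(i < k.+2) (r i)%:num%:E * \int[law (p i)]_(x in xsection D i) f (i, x).
Proof.
move=> mD mf f0.
(* [msum] is indexed by natural numbers, so the levels are recovered through [inord]. *)
pose m j : {measure set ('I_k.+2 * X) -> \bar R} :=
  at_level (inord j : 'I_k.+2)
    (mscale (NngNum [ge0 of (r (inord j))%:num]) (law (p (inord j)))).
rewrite (eq_measure_integral (msum m k.+2)); last first.
  move=> A mA _; rewrite [LHS]st_lawE//; apply: eq_bigr => i _.
  by rewrite /m/= /at_level/= inord_val.
rewrite ge0_integral_measure_sum//; last exact: measurable_funTS.
apply: eq_bigr => i _; rewrite /m inord_val integral_at_level//.
rewrite ge0_integral_mscale//.
- exact: measurable_xsection.
- apply: measurable_funTS; exact: measurableT_comp (pair1_measurable i).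
Qed.

End tempering_integral.

(** * The flow between components at a fixed point *)

Section projected_flow.
Context (R : realFieldType).

(** Passing through y costs a factor 2. Each of the two endpoint terms then sums to at most 2 sum_j
    u_j (y - c_j)^2, because the ratios u_l / s sum to at most 1. *)
Lemma same_level_flow (J : finType) (u c : J -> R) (y : R) :
  (forall j, 0 <= u j) ->
  \sum_j \sum_l (c l - c j) ^+ 2 * (u j * u l / \sum_m u m)
    <= 4 * \sum_j u j * (y - c j) ^+ 2.
Proof.
move=> u0; set s := \sum_m u m.
have s0 : 0 <= s by exact: sumr_ge0.
pose F j l := 2 * ((y - c j) ^+ 2 * u j) * (u l / s).
have FS : \sum_j \sum_l F j l <= 2 * \sum_j u j * (y - c j) ^+ 2.
  rewrite mulr_sumr; apply: ler_sum => j _; rewrite -mulr_sumr -mulr_suml -/s.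
  rewrite [u j * _]mulrC; apply: ler_piMr.
    by apply: mulr_ge0 => //; apply: mulr_ge0; rewrite ?sqr_ge0.

  (* When s = 0 division by zero gives 0, so the ratios sum to 0 instead of 1. *)
  have [->|s_neq0] := eqVneq s 0; first by rewrite mul0r.
  by rewrite divff.
have -> : 4 * \sum_j u j * (y - c j) ^+ 2 =
    2 * \sum_j u j * (y - c j) ^+ 2 + 2 * \sum_j u j * (y - c j) ^+ 2 by ring.
apply: le_trans (lerD FS FS); rewrite [X in _ + X]exchange_big/= -big_split/=.
apply: ler_sum => j _; rewrite -big_split/=; apply: ler_sum => l _.
have -> : F j l + F l j =
    2 * ((y - c j) ^+ 2 + (y - c l) ^+ 2) * (u j * u l / s).
  by rewrite /F; ring.
apply: ler_wpM2r; first by rewrite divr_ge0 ?mulr_ge0.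
(* This square is the difference 2 (A^2 + B^2) - (A - B)^2 for A = y - c_j and B = y - c_l. *)
by have := sqr_ge0 ((y - c j) + (y - c l)); nra.
Qed.

(** The difference c'_j - c_j is split into three increments through y and y'. The minimum is
    bounded by u_j in the first and by u'_j in the last; in the middle one it is summed over j
    before being bounded. *)
Lemma swap_flow (J : finType) (u u' c c' : J -> R) (y y' : R) :
  (forall j, 0 <= u j) -> (forall j, 0 <= u' j) ->
  \sum_j (c' j - c j) ^+ 2 * Num.min (u j) (u' j)
    <= 3 * (\sum_j u j * (y - c j) ^+ 2 + \sum_j u' j * (y' - c' j) ^+ 2
            + Num.min (\sum_j u j) (\sum_j u' j) * (y' - y) ^+ 2).
Proof.
move=> u0 u'0.
have minS : \sum_j Num.min (u j) (u' j) <= Num.min (\sum_j u j) (\sum_j u' j).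
  by rewrite le_min; apply/andP; split; apply: ler_sum => j _;
    rewrite ge_min lexx ?orbT.
apply: (@le_trans _ _ (3 * (\sum_j u j * (y - c j) ^+ 2
    + \sum_j u' j * (y' - c' j) ^+ 2
    + (\sum_j Num.min (u j) (u' j)) * (y' - y) ^+ 2))); last first.
  by rewrite ler_pM2l// lerD2l ler_wpM2r ?sqr_ge0.
rewrite mulr_suml -!big_split/= mulr_sumr; apply: ler_sum => j _.
set m := Num.min _ _.
have m0 : 0 <= m by rewrite le_min u0 u'0.
have mu : m <= u j by rewrite ge_min lexx.
have mu' : m <= u' j by rewrite ge_min lexx orbT.
apply: (@le_trans _ _ (3 * (m * (y - c j) ^+ 2 + m * (y' - c' j) ^+ 2
    + m * (y' - y) ^+ 2))); last first.
  by rewrite ler_pM2l// lerD2r lerD// ler_wpM2r ?sqr_ge0.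
rewrite -!mulrDr mulrCA [leLHS]mulrC; apply: ler_wpM2l => //.
(* With A = y - c_j, B = y' - y and C = y' - c'_j, one has c'_j - c_j = A + B - C, and these three
   squares add up to 3 (A^2 + B^2 + C^2) - (A + B - C)^2. *)
have := sqr_ge0 ((y - c j) - (y' - y)).
have := sqr_ge0 ((y - c j) + (y' - c' j)).
have := sqr_ge0 ((y' - y) + (y' - c' j)).
nra.
Qed.

(** * Neighbouring levels and proposals *)

Section levels.
Variable k : nat.

(** Written exactly as the test in [proj_offdiag], so that unfolding identifies the two. *)
Definition adjacent (i i' : 'I_k.+2) :=
  (i' == i.+1 :> nat) || (i == i'.+1 :> nat).

Lemma adjacent_sym i i' : adjacent i i' = adjacent i' i.
Proof. by rewrite /adjacent orbC. Qed.

(** The two proposals reach the distinct levels i + 1 and i - 1, and one that leaves the range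
    contributes 0. This turns the swap part of the kernel into a sum over neighbours. *)
Lemma sum_propose (V : nmodType) (F : 'I_k.+2 -> V) i :
  (if propose true i is Some i' then F i' else 0) +
    (if propose false i is Some i' then F i' else 0)
  = \sum_(i' | adjacent i i') F i'.
Proof.
rewrite /adjacent (bigID (fun i' : 'I_k.+2 => i' == i.+1 :> nat))/=.
congr (_ + _).
- rewrite /propose; case: insubP => [i' _ i'E|iN].
    by rewrite (big_pred1 i')// => j; rewrite -[RHS]val_eqE/= i'E; lia.
  rewrite big_pred0// => j; apply/negbTE; apply: contra iN => /andP[_ /eqP <-].
  exact: ltn_ord.
- rewrite /propose; case: i => [[|i] hi] /=.
    by rewrite big_pred0// => j; rewrite orbF andbN.
  case: insubP => [i' _ i'E|]; last by rewrite (ltnW hi).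
  by rewrite (big_pred1 i')// => j; rewrite -[RHS]val_eqE/= i'E; lia.
Qed.

(** A level has at most two neighbours; b >= 0 accounts for the missing one at either end. *)
Lemma sum_adjacent_le (i : 'I_k.+2) (b : R) : 0 <= b ->
  \sum_(i' | adjacent i i') b <= 2 * b.
Proof.
move=> b0; rewrite -sum_propose mulr_natl mulr2n.
by apply: lerD; case: propose.
Qed.

End levels.

Variables (k n : nat) (lam : R).
Local Notation index := ('I_k.+2 * 'I_n)%type.

(** The stationary flow of the projected chain before integration over x: with [u a] = r_i w_(i,j)
    p_(i,j)(x), its integral over X0 represents theta Pbar(a) Mbar(a, b) for a <> b. It is 0 on the
    diagonal. *)
Definition flow (u : index -> R) (a b : index) : R :=
  if (b.1 == a.1) && (b.2 != a.2) then
    (1 - lam) * (u a * u b / \sum_j u (a.1, j))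
  else if adjacent a.1 b.1 && (b.2 == a.2) then
    lam / 2 * Num.min (u a) (u b)
  else 0.

Lemma flow_ge0 u a b : 0 <= lam <= 1 -> (forall c, 0 <= u c) -> 0 <= flow u a b.
Proof.
move=> /andP[l0 l1] u0; rewrite /flow; case: ifP => _.
  by rewrite mulr_ge0 ?subr_ge0// divr_ge0 ?mulr_ge0// sumr_ge0.
by case: ifP => // _; rewrite mulr_ge0 ?divr_ge0// le_min !u0.
Qed.

(** Moves within a level contribute 4 (1 - lam) to the first coefficient. In the swaps each level
    occurs at most twice as source and twice as target, which contributes 3 (lam / 2) 4 = 6 lam; the
    total is 2 (2 + lam). *)
Lemma flow_energy_le (u c : index -> R) (y : 'I_k.+2 -> R) :
  0 <= lam <= 1 -> (forall a, 0 <= u a) ->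
  \sum_a \sum_b (c b - c a) ^+ 2 * flow u a b
    <= 2 * (2 + lam) * \sum_a u a * (y a.1 - c a) ^+ 2
       + 3 * (lam / 2) * \sum_i \sum_(i' | adjacent i i')
           Num.min (\sum_j u (i, j)) (\sum_j u (i', j)) * (y i' - y i) ^+ 2.
Proof.
move=> /andP[l0 l1] u0.
have l20 : 0 <= lam / 2 by rewrite divr_ge0.
pose V i := \sum_j u (i, j) * (y i - c (i, j)) ^+ 2.
have V0 i : 0 <= V i.
  by apply: sumr_ge0 => j _; rewrite mulr_ge0 ?sqr_ge0.
have VE : \sum_a u a * (y a.1 - c a) ^+ 2 = \sum_i V i.
  by rewrite pair_big/=; apply: eq_bigr => -[].
pose same i := \sum_j \sum_l (c (i, l) - c (i, j)) ^+ 2 *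
  (u (i, j) * u (i, l) / \sum_m u (i, m)).
pose swap i i' := \sum_j (c (i', j) - c (i, j)) ^+ 2 *
  Num.min (u (i, j)) (u (i', j)).
have pairE (G : index -> R) : \sum_a G a = \sum_i \sum_j G (i, j).
  by rewrite pair_big/=; apply: eq_bigr => -[].
have adjxx i : adjacent i i = false by rewrite /adjacent; lia.
(* The sums [same i] include l = j, where the square vanishes. *)
have splitE : \sum_a \sum_b (c b - c a) ^+ 2 * flow u a b =
    (1 - lam) * \sum_i same i
    + lam / 2 * \sum_i \sum_(i' | adjacent i i') swap i i'.
  rewrite pairE !mulr_sumr -big_split/=; apply: eq_bigr => i _.
  rewrite [in RHS]exchange_big/= !mulr_sumr -big_split/=.
  apply: eq_bigr => j _; rewrite pairE (bigD1 i)//=; congr (_ + _).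
    rewrite mulr_sumr; apply: eq_bigr => l _; rewrite /flow/= eqxx adjxx/=.
    have [->|_] := eqVneq l j; first by rewrite subrr; ring.
    by rewrite /=; ring.
  rewrite mulr_sumr big_mkcond [RHS]big_mkcond/=; apply: eq_bigr => i' _.
  have [->|i'i] := eqVneq i' i; first by rewrite adjxx.
  rewrite (bigD1 j)//= big1 => [|l /negPf lj]; rewrite /flow/= (negPf i'i)/=.
    by rewrite eqxx andbT; case: ifP => _; ring.
  by rewrite lj andbF mulr0.
rewrite splitE.
have same_le : \sum_i same i <= 4 * \sum_i V i.
  rewrite mulr_sumr; apply: ler_sum => i _; exact: same_level_flow.
set W := \sum_i \sum_(i' | adjacent i i') Num.min _ _ * _.
have swap_le : \sum_i \sum_(i' | adjacent i i') swap i i' <=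
    3 * (4 * \sum_i V i + W).
  have VS : \sum_i \sum_(i' | adjacent i i') V i <= 2 * \sum_i V i.
    by rewrite mulr_sumr; apply: ler_sum => i _; exact: sum_adjacent_le.
  have VS' : \sum_i \sum_(i' | adjacent i i') V i' <= 2 * \sum_i V i.
    rewrite (exchange_big_dep predT)//=.
    by under eq_bigr do under eq_bigl do rewrite adjacent_sym.
  have -> : 4 * \sum_i V i = 2 * \sum_i V i + 2 * \sum_i V i by ring.
  apply: (@le_trans _ _ (3 * (\sum_i \sum_(i' | adjacent i i') V i +
    \sum_i \sum_(i' | adjacent i i') V i' + W))); last first.
    by rewrite ler_pM2l// lerD2r lerD.
  rewrite -!big_split/= mulr_sumr; apply: ler_sum => i _.
  rewrite -!big_split/= mulr_sumr; apply: ler_sum => i' _.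
  exact: swap_flow.
rewrite VE; set S := \sum_i V i in same_le swap_le *.
have := ler_wpM2l l20 swap_le.
have := @ler_wpM2l _ (1 - lam) _ _ _ same_le.
rewrite subr_ge0 => /(_ l1); nra.
Qed.

End projected_flow.

(** * Variance decomposition *)

Section second_moment.
Local Open Scope ereal_scope.
Context d (X : measurableType d) (R : realType).
Implicit Types (nu : {finite_measure set X -> \bar R}) (O : set X).

Definition mean_on O nu (h : X -> R) : R :=
  (\int[nu]_(x in O) h x / fine (nu O))%R.

(** Not divided by [nu O]: this is the mass of O times the variance of h under the normalised
    restriction. *)
Definition scatter_on O nu (h : X -> R) : R :=
  (\int[nu]_(x in O) (h x - mean_on O nu h) ^+ 2)%R.

Lemma scatter_on_ge0 O nu h : (0 <= scatter_on O nu h)%R.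
Proof. by apply: Rintegral_ge0 => x _; exact: sqr_ge0. Qed.

Section fixed.
Variables (nu : {finite_measure set X -> \bar R}) (O : set X) (h : X -> R).
Hypotheses (mO : measurable O) (nuO : 0 < nu O)
  (mh : measurable_fun [set: X] h)
  (h2 : nu.-integrable [set: X] (EFin \o (fun x => h x ^+ 2)%R)).

Let m := fine (nu O).
Let c := mean_on O nu h.

Let nuOE : nu O = m%:E.
Proof. by rewrite /m fineK// fin_num_measure. Qed.

Let m0 : m != 0%R.
Proof. by move: nuO; rewrite nuOE lte_fin => /gt_eqF ->. Qed.

Let ih : nu.-integrable O (EFin \o h).
Proof.
(* |h| <= 1 + h^2, and constants are integrable for a finite measure. *)
apply: (@le_integrable _ _ _ _ _ mO _ (EFin \o (fun x => 1 + h x ^+ 2)%R)).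
- by apply/measurable_EFinP; exact: measurable_funTS.
- move=> x _; rewrite /= lee_fin [leRHS]ger0_norm ?addr_ge0 ?sqr_ge0//.
  have [hx|hx] := lerP `|h x| 1.
    by rewrite (le_trans hx)// lerDl sqr_ge0.
  by rewrite -real_normK ?num_real//; nra.
- rewrite (_ : _ \o _ = (cst 1) \+ (EFin \o (fun x => h x ^+ 2)%R))//.
  apply: integrableD => //; first exact: finite_measure_integrable_cst.
  exact: (integrableS measurableT).
Qed.

Let ihc : \int[nu]_(x in O) (h x)%:E = (c * m)%:E.
Proof.
rewrite /c /mean_on -/m divfK// /Rintegral fineK//.
exact: (integrable_fin_num mO ih).
Qed.

Let affine_integrable (a b : R) :
  nu.-integrable O (fun x => (a * h x + b)%:E).
Proof.
under eq_fun do rewrite EFinD EFinM.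
apply: integrableD => //; first exact: integrableZl.
exact: finite_measure_integrable_cst.
Qed.

Let sqr_dist_integrable (e : R) : nu.-integrable O (fun x => ((h x - e) ^+ 2)%:E).
Proof.
rewrite (_ : (fun _ => _) = (EFin \o (fun x => h x ^+ 2)%R) \+
    (fun x => ((- (2 * e)) * h x + e ^+ 2)%:E)); last first.
  by apply/funext => x; rewrite /= -EFinD; congr EFin; ring.
apply: integrableD => //.
exact: (integrableS measurableT).
Qed.

(** Expanding around the mean c leaves an affine function of h, whose integral is computed from that
    of h and equals m (c - e)^2. *)
Lemma integral_sqr_dist (e : R) :
  \int[nu]_(x in O) ((h x - e) ^+ 2)%:E
  = (scatter_on O nu h + m * (c - e) ^+ 2)%:E.
Proof.
have -> : (scatter_on O nu h + m * (c - e) ^+ 2)%:E =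
    \int[nu]_(x in O) ((h x - c) ^+ 2)%:E + (m * (c - e) ^+ 2)%:E.
  rewrite EFinD; congr (_ + _); rewrite /scatter_on -/c /Rintegral fineK//.
  exact: (integrable_fin_num mO).
transitivity (\int[nu]_(x in O) (((h x - c) ^+ 2)%:E +
    (2 * (c - e) * h x + (e ^+ 2 - c ^+ 2))%:E)).
  by apply: eq_integral => x _; rewrite -EFinD; congr EFin; ring.
rewrite integralD//; congr (_ + _).
under eq_integral do rewrite EFinD EFinM.
rewrite integralD//; last 2 first.
- exact: integrableZl.
- exact: finite_measure_integrable_cst.
rewrite integralZl// ihc integral_cst// [X in _ + _ * X]nuOE -!EFinM -EFinD; congr EFin; ring.
Qed.

(** The integrand has the shape of the inner integral of a variance after [integral_sqr_dist], so
    the outer integral can be evaluated too. *)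
Lemma integral_affine_sqr_dist (a b e : R) : (0 <= a)%R -> (0 <= b)%R ->
  \int[nu]_(x in O) (a + b * (e - h x) ^+ 2)%:E
  = (a * m + b * (scatter_on O nu h + m * (c - e) ^+ 2))%:E.
Proof.
move=> a0 b0; under eq_integral do rewrite EFinD EFinM.
have mD : measurable_fun O (fun x => ((e - h x) ^+ 2)%:E).
  apply/measurable_EFinP/measurable_funTS.
  by apply: measurable_funX; exact: measurable_funB.
rewrite ge0_integralD//; last 2 first.
- by move=> x _; rewrite -EFinM lee_fin mulr_ge0 ?sqr_ge0.
- exact: measurable_funeM.
rewrite ge0_integralZl_EFin//; last by move=> x _; rewrite lee_fin sqr_ge0.
under [X in _ + _ * X]eq_integral do rewrite -sqrrN opprB.
by rewrite integral_sqr_dist integral_cst// [X in _ * X + _]nuOE.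
Qed.

(** The inner integral v + m (c - h)^2 integrates to 2 m v, and the prefactor 1/2 removes the 2. *)
Lemma variance_onE : variance_on O nu h = (m * scatter_on O nu h)%:E.
Proof.
rewrite /variance_on; set v := scatter_on _ _ _.
under eq_integral do rewrite integral_sqr_dist -/v.
rewrite integral_affine_sqr_dist ?scatter_on_ge0 ?fine_ge0// -/v.
by rewrite -EFinM; congr EFin; field.
Qed.

End fixed.
End second_moment.

Section square_integrable.
Local Open Scope ereal_scope.
Context d (X : measurableType d) (R : realType).

Lemma sqr_integrable_Lfun2 (nu : {measure set X -> \bar R}) (f : X -> R) :
  measurable_fun [set: X] f ->
  nu.-integrable [set: X] (EFin \o (fun x => f x ^+ 2)%R) ->
  f \in Lfun nu 2%:E.
Proof.
move=> mf /integrableP[_ f2]; rewrite inE; apply/andP; split; rewrite inE//=.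
rewrite /finite_norm unlock poweR_lty//; apply: le_lt_trans f2.
rewrite le_eqVlt; apply/orP; left; apply/eqP/eq_integral => x _ /=; congr EFin.
by rewrite normrX powR_mulrn.
Qed.

End square_integrable.

(** * Mixtures of densities *)

Section mixture.
Local Open Scope ereal_scope.
Context d (X : measurableType d) (R : realType)
  (mu : {measure set X -> \bar R}) (n : nat).
Variables (q : density mu) (qc : 'I_n -> density mu) (w : 'I_n -> R).
Hypotheses (w0 : forall j, (0 <= w j)%R)
  (qE : forall x, q x = (\sum_(j < n) w j * qc j x)%R).

Lemma integral_mixture (D : set X) (f : X -> \bar R) : measurable D ->
  measurable_fun D f -> (forall x, D x -> 0 <= f x) ->
  \int[law q]_(x in D) f x = \sum_(j < n) (w j)%:E * \int[law (qc j)]_(x in D) f x.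
Proof.
move=> mD mf f0; rewrite integral_law//.
have mqf j : measurable_fun D (fun x => (qc j x)%:E * f x).
  by apply: emeasurable_funM => //; exact: measurable_EFin_dens.
have qf0 j x : D x -> 0 <= (qc j x)%:E * f x.
  by move=> Dx; rewrite mule_ge0 ?lee_fin ?dens_ge0 ?f0.
transitivity (\int[mu]_(x in D) \sum_(j < n) (w j)%:E * ((qc j x)%:E * f x)).
  apply: eq_integral => x _; rewrite qE -sumEFin ge0_sume_distrl.
    by apply: eq_bigr => j _; rewrite EFinM muleA.
  by move=> j _; rewrite lee_fin mulr_ge0 ?dens_ge0.
rewrite ge0_integral_sum//; last 2 first.
- by move=> j; exact: measurable_funeM.
- by move=> j x Dx; rewrite mule_ge0 ?lee_fin ?qf0.
by apply: eq_bigr => j _; rewrite ge0_integralZl_EFin ?integral_law ?w0// => x; exact: qf0.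
Qed.

(** Each term of the finite sum for [law q] is finite, and a positive weight can be cancelled. A
    component of weight 0 is not controlled in this way. *)
Lemma integrable_mixture (f : X -> R) (j : 'I_n) : (0 < w j)%R ->
  (law q).-integrable [set: X] (EFin \o f) ->
  (law (qc j)).-integrable [set: X] (EFin \o f).
Proof.
move=> wj /integrableP[mf fq]; apply/integrableP; split => //.
have mfa : measurable_fun [set: X] (fun x => `|(EFin \o f) x|).
  exact: measurableT_comp.
rewrite integral_mixture// in fq.
have : (w j)%:E * \int[law (qc j)]_x `|(EFin \o f) x| < +oo.
  apply: le_lt_trans fq; rewrite (bigD1 j)//= leeDl// sume_ge0// => i _.
  by rewrite mule_ge0 ?lee_fin ?w0// integral_ge0.
rewrite !ltey; apply: contra => /eqP ->.
by rewrite gt0_muley// lte_fin.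
Qed.

End mixture.

Section tempering_Lfun.
Local Open Scope ereal_scope.
Context d (X : measurableType d) (R : realType)
  (mu : {measure set X -> \bar R}) (k : nat).
Variables (p : 'I_k.+2 -> density mu) (r : 'I_k.+2 -> {posnum R}).

(** The term of level i in the integral of g^2 is finite, and r_i > 0 can be cancelled. *)
Lemma Lfun_st_law (g : 'I_k.+2 * X -> R) (i : 'I_k.+2) :
  g \in Lfun (st_law p r) 2%:E ->
  (law (p i)).-integrable [set: X] (EFin \o (fun x => g (i, x) ^+ 2)%R).
Proof.
move=> g2; have /integrableP[mg ig] := Lfun2_integrable_sqr g2.
apply/integrableP; split.
  exact: (measurableT_comp mg (pair1_measurable i)).
rewrite (integral_st_law p r measurableT) in ig => //; last first.
  exact: measurableT_comp.
have : (r i)%:num%:E * \int[law (p i)]_x `|(g (i, x) ^+ 2)%:E| < +oo.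
  apply: le_lt_trans ig; rewrite (bigD1 i)//= xsectionE preimage_setT leeDl//.
  by apply: sume_ge0 => j _; rewrite mule_ge0 ?integral_ge0.
rewrite !ltey; apply: contra => /eqP ->.
by rewrite gt0_muley// lte_fin.
Qed.

End tempering_Lfun.

(** * Variance within and between the components *)

Section variance_decomposition.
Local Open Scope ereal_scope.
Context d (X : measurableType d) (R : realType)
  (mu : {measure set X -> \bar R}) (k n : nat).
Variables (p : 'I_k.+2 -> density mu) (r : 'I_k.+2 -> {posnum R})
  (w : 'I_k.+2 -> 'I_n -> R) (pc : 'I_k.+2 -> 'I_n -> density mu)
  (X0 : set X) (g : 'I_k.+2 * X -> R).
Hypotheses (mX0 : measurable X0) (w0 : forall i j, (0 <= w i j)%R)
  (pE : forall i x, p i x = (\sum_(j < n) w i j * pc i j x)%R)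
  (pc0 : forall i j, 0 < law (pc i j) X0)
  (g2 : g \in Lfun (st_law p r) 2%:E).

Local Notation index := ('I_k.+2 * 'I_n)%type.
Local Notation strip := ([set: 'I_k.+2] `*` X0).

Definition comp_weight (a : index) : R := ((r a.1)%:num * w a.1 a.2)%R.

Definition comp_mean (a : index) : R :=
  mean_on X0 (law (pc a.1 a.2)) (fun x => g (a.1, x)).

Definition comp_scatter (a : index) : R :=
  scatter_on X0 (law (pc a.1 a.2)) (fun x => g (a.1, x)).

Local Notation weight := comp_weight.
Local Notation mass := (comp_mass pc X0).

Lemma comp_weight_ge0 a : (0 <= weight a)%R.
Proof. by rewrite mulr_ge0. Qed.

Lemma comp_mass_gt0 a : (0 < mass a)%R.
Proof. by rewrite fine_gt0// pc0/= ltey_eq fin_num_measure. Qed.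

Lemma comp_massE a : law (pc a.1 a.2) X0 = (mass a)%:E.
Proof. by rewrite fineK// fin_num_measure. Qed.

Let mstrip : measurable strip. Proof. exact: measurableX. Qed.

Let xstrip i : xsection strip i = X0.
Proof. by rewrite in_xsectionX// inE. Qed.

Lemma integral_st_law_comp (f : 'I_k.+2 * X -> \bar R) :
  measurable_fun [set: 'I_k.+2 * X] f -> (forall z, 0 <= f z) ->
  \int[st_law p r]_(z in strip) f z
  = \sum_a (weight a)%:E * \int[law (pc a.1 a.2)]_(x in X0) f (a.1, x).
Proof.
move=> mf f0; rewrite integral_st_law//.
rewrite -(pair_bigA _ (fun i j =>
  (weight (i, j))%:E * \int[law (pc i j)]_(x in X0) f (i, x)))/=.
apply: eq_bigr => i _; rewrite xstrip (integral_mixture (w0 i) (pE i))//.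
  rewrite ge0_sume_distrr => [|j _]; last first.
    by rewrite mule_ge0 ?lee_fin ?w0 ?integral_ge0.
  by apply: eq_bigr => j _; rewrite muleA.
by apply: measurable_funTS; apply: (measurableT_comp mf); exact: pair1_measurable.
Qed.

Lemma st_law_strip : st_law p r strip = (\sum_a weight a * mass a)%:E.
Proof.
rewrite -[LHS]mul1e -(integral_cst (st_law p r) mstrip).
rewrite integral_st_law_comp//.
by rewrite -sumEFin; apply: eq_bigr => a _; rewrite integral_cst// mul1e [RHS]EFinM -comp_massE.
Qed.

Lemma measurable_Lfun (f : 'I_k.+2 * X -> R) : f \in Lfun (st_law p r) 2%:E ->
  measurable_fun [set: 'I_k.+2 * X] f.
Proof. by move=> /sub_Lfun_mfun; rewrite inE. Qed.

Let mg := measurable_Lfun g2.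

Lemma measurable_level (i : 'I_k.+2) :
  measurable_fun [set: X] (fun x => g (i, x)).
Proof. exact: (measurableT_comp mg (pair1_measurable i)). Qed.

Lemma comp_sqr_integrable a : (0 < w a.1 a.2)%R ->
  (law (pc a.1 a.2)).-integrable [set: X] (EFin \o (fun x => g (a.1, x) ^+ 2)%R).
Proof.
by move=> wa; apply: (integrable_mixture (w0 a.1) (pE a.1) wa); exact: Lfun_st_law g2.
Qed.

(** In a component of weight 0 the function may fail to be square integrable, but there both sides
    vanish. Keeping the weight in the statement lets it hold for every a. *)
Lemma integral_comp_affine (a : index) (s t e : R) : (0 <= s)%R -> (0 <= t)%R ->
  (weight a)%:E * \int[law (pc a.1 a.2)]_(x in X0) (s + t * (e - g (a.1, x)) ^+ 2)%:E
  = (weight a * (s * mass a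
      + t * (comp_scatter a + mass a * (comp_mean a - e) ^+ 2)))%:E.
Proof.
move=> s0 t0; have := w0 a.1 a.2; rewrite le_eqVlt => /predU1P[wa|wa].
  by rewrite /comp_weight -wa mulr0 mul0e mul0r.
rewrite integral_affine_sqr_dist//.
- exact: pc0.
- exact: measurable_level.
- exact: comp_sqr_integrable.
Qed.

(** Both integrals are evaluated component by component. The first summand is theta times the
    weighted scatters; the second is theta^2 times the variance of the component means under
    Pbar. *)
Lemma variance_st_law :
  variance_on strip (st_law p r) g =
  ((\sum_a weight a * mass a) * \sum_a weight a * comp_scatter a
   + 2^-1 * \sum_a \sum_b (comp_mean b - comp_mean a) ^+ 2
       * (weight a * mass a) * (weight b * mass b))%:E.
Proof.
rewrite /variance_on.
under eq_integral => z _.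
  rewrite integral_st_law_comp//; last 2 first.
  - by apply/measurable_EFinP; apply: measurable_funX; exact: measurable_funB.
  - by move=> z'; rewrite lee_fin sqr_ge0.
  under eq_bigr => b _.
    (* The square is brought to the form s + t (e - g)^2 with s = 0, t = 1 and e = g z. *)
    under eq_integral do rewrite -sqrrN opprB -[X in X%:E]mul1r -[X in X%:E]add0r.
    rewrite integral_comp_affine// mul0r add0r mul1r; over.
  rewrite sumEFin; over.
rewrite integral_st_law_comp; last 2 first.
- apply/measurable_EFinP; apply: measurable_sum => b.
  apply: measurable_funM => //; apply: measurable_funD => //.
  apply: measurable_funM => //; apply: measurable_funX; exact: measurable_funB.
- move=> z; rewrite lee_fin sumr_ge0// => b _.
  rewrite mulr_ge0 ?comp_weight_ge0// addr_ge0 ?scatter_on_ge0//.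
  by rewrite mulr_ge0 ?sqr_ge0// ltW ?comp_mass_gt0.
under eq_bigr => a _.
  under eq_integral => x _ do rewrite -sumEFin.
  rewrite ge0_integral_sum//; last 2 first.
  - move=> b; apply/measurable_EFinP/measurable_funTS.
    apply: measurable_funM => //; apply: measurable_funD => //.
    apply: measurable_funM => //; apply: measurable_funX.
    by apply: measurable_funB => //; exact: measurable_level.
  - move=> b x _; rewrite lee_fin mulr_ge0 ?comp_weight_ge0// addr_ge0 ?scatter_on_ge0//.
    by rewrite mulr_ge0 ?sqr_ge0// ltW ?comp_mass_gt0.
  rewrite ge0_sume_distrr; last first.
    move=> b _; rewrite integral_ge0// => x _.
    rewrite lee_fin mulr_ge0 ?comp_weight_ge0// addr_ge0 ?scatter_on_ge0//.
    by rewrite mulr_ge0 ?sqr_ge0// ltW ?comp_mass_gt0.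
  under eq_bigr => b _.
    (* Now s and t are the weight of b times its scatter and its mass, and e is the mean of b. *)
    under eq_integral do rewrite mulrDr mulrA.
    rewrite integral_comp_affine; last 2 first.
      by rewrite mulr_ge0 ?comp_weight_ge0// scatter_on_ge0.
      by rewrite mulr_ge0 ?comp_weight_ge0// ltW ?comp_mass_gt0.
    over.
  rewrite sumEFin; over.
rewrite sumEFin -EFinM; congr EFin.
set S := (\sum_a weight a * mass a)%R.
set T := (\sum_a weight a * comp_scatter a)%R.
(* The scatters of a and of b both occur under the prefactor 1/2; symmetrising the product S T
   matches the two. *)
have ST : (S * T = 2^-1 * (\sum_a \sum_b (weight a * mass a) * (weight b * comp_scatter b)
   + \sum_a \sum_b (weight a * comp_scatter a) * (weight b * mass b)))%R.
  have prodE (F G : index -> R) : (\sum_a \sum_b F a * G b = (\sum_a F a) * \sum_b G b)%R.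
    by rewrite mulr_suml; apply: eq_bigr => a _; rewrite mulr_sumr.
  by rewrite !prodE -/S -/T; field.
rewrite ST -mulrDr -!big_split/=; congr (_ * _)%R; apply: eq_bigr => a _.
rewrite -!big_split/=; apply: eq_bigr => b _; ring.
Qed.

End variance_decomposition.

(** * Dirichlet form of the tempering chain *)

(** The Metropolis flow, symmetric in the two densities. At v = 0 both sides are 0, since u >= 0. *)
Lemma accept_min (R : realType) (u v : R) :
  0 <= u -> 0 <= v -> v * accept u v = Num.min v u.
Proof.
move=> u0 v0; rewrite /accept; case: eqVneq => [->|vN].
  by rewrite mul0r min_l.
by rewrite minC minr_pMr// mulrCA divff// !mulr1 minC.
Qed.

Section tempering_dirichlet.
Local Open Scope ereal_scope.
Context d (X : measurableType d) (R : realType)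
  (mu : {measure set X -> \bar R}) (k : nat).
Variables (p : 'I_k.+2 -> density mu) (r : 'I_k.+2 -> {posnum R})
  (M : 'I_k.+2 -> R.-pker X ~> X) (lambda : {itv R & `]0, 1[}) (X0 : set X).
Hypothesis mX0 : measurable X0.

Local Notation state := ('I_k.+2 * X)%type.
Local Notation strip := ([set: 'I_k.+2] `*` X0).
Local Notation lam := (lambda%:num).

Let mstrip : measurable strip. Proof. exact: measurableX. Qed.

Let xstrip i : xsection strip i = X0.
Proof. by rewrite in_xsectionX// inE. Qed.

Let accept0 z z' : (0 <= st_accept p r z z')%R.
Proof. by apply: accept_ge0; apply: mulr_ge0 => //; exact: dens_ge0. Qed.

Let reject0 z z' : (0 <= 1 - st_accept p r z z')%R.
Proof. by rewrite subr_ge0 accept_le1. Qed.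

Section at_state.
Variables (z : state) (f : state -> \bar R).
Hypotheses (mf : measurable_fun [set: state] f) (f0 : forall z, 0 <= f z)
  (zX0 : X0 z.2) (fz : f z = 0).

(** Rejection stays at z, where f vanishes, so only the accepted move counts; it keeps x and hence
    stays in the strip. The measure is an existential witness because [st_swap] is a bare set
    function. *)
Lemma integral_st_swap b : exists2 m : {measure set state -> \bar R},
  st_swap p r b z = m &
  \int[m]_(z' in strip) f z' =
  if propose b z.1 is Some i' then
    (st_accept p r z (i', z.2))%:E * f (i', z.2) else 0.
Proof.
have mfs : measurable_fun strip f by exact: measurable_funTS.
have dz : \int[\d_z]_(z' in strip) f z' = 0.
  by rewrite integral_dirac// fz mule0.
rewrite /st_swap; case: propose => [i'|]; last by exists \d_z.
exists (measure_add
  (mscale (NngNum (accept0 z (i', z.2))) (\d_(i', z.2)))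
  (mscale (NngNum (reject0 z (i', z.2))) (\d_z))).
  by apply/funext => A; rewrite -[RHS]/(measure_add _ _ A) measure_addE.
rewrite ge0_integral_measure_add// !ge0_integral_mscale// dz mule0 adde0.
by rewrite integral_dirac//= diracE mem_set// mul1e.
Qed.

Lemma integral_st_chain :
  \int[st_chain p r M lambda z]_(z' in strip) f z' =
  (1 - lam)%:E * \int[M z.1 z.2]_(y in X0) f (z.1, y) +
  (lam / 2)%:E * \sum_(i' | adjacent z.1 i')
    (st_accept p r z (i', z.2))%:E * f (i', z.2).
Proof.
have mfs : measurable_fun strip f by exact: measurable_funTS.
have [m1 m1E im1] := integral_st_swap true.
have [m2 m2E im2] := integral_st_swap false.
pose m : {measure set state -> \bar R} := measure_add
  (mscale (NngNum [ge0 of (1 - lam)%R]) (at_level z.1 (M z.1 z.2)))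
  (mscale (NngNum [ge0 of (lam / 2)%R]) (measure_add m1 m2)).
rewrite (eq_measure_integral m); last first.
  move=> A mA _; rewrite -[LHS]/(st_kernel p r M lambda z A).
  rewrite /st_kernel m1E m2E -[RHS]/(measure_add _ _ A) measure_addE.
  rewrite /mscale/= -[X in _ = _ + _ * X]/(measure_add _ _ A) measure_addE.
  rewrite -ge0_muleDr// muleA -EFinM; congr (_ + _).
rewrite ge0_integral_measure_add// !ge0_integral_mscale//.
rewrite ge0_integral_measure_add// im1 im2 integral_at_level// xstrip.
congr (_ + _ * _).
exact: (sum_propose (fun i' => (st_accept p r z (i', z.2))%:E * f (i', z.2))).
Qed.

End at_state.

Variable g : state -> R.
Hypothesis mg : measurable_fun [set: state] g.

Let mgi i : measurable_fun [set: X] (fun x => g (i, x)).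
Proof. exact: (measurableT_comp mg (pair1_measurable i)). Qed.

Let sqr_diff_measurable (u v : X -> R) : measurable_fun [set: X] u ->
  measurable_fun [set: X] v ->
  measurable_fun [set: X] (fun x => ((u x - v x) ^+ 2)%:E).
Proof.
move=> mU mv; apply/measurable_EFinP; apply: measurable_funX.
exact: measurable_funB.
Qed.

(** The restriction to X0 becomes an indicator factor, so that measurability of kernel integrals
    over the whole space applies. *)
Let measurable_jump i :
  measurable_fun [set: X]
    (fun x => \int[M i x]_(y in X0) ((g (i, y) - g (i, x)) ^+ 2)%:E).
Proof.
pose h (z : X * X) := ((g (i, z.2) - g (i, z.1)) ^+ 2 * \1_X0 z.2)%:E.
rewrite (_ : (fun _ => _) = (fun x => \int[M i x]_y h (x, y))); last first.
  apply/funext => x; rewrite [LHS]integral_mkcond; apply: eq_integral => y _.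
  by rewrite epatch_indic.
apply: measurable_fun_integral_sfinite_kernel.
- by move=> z; rewrite lee_fin mulr_ge0 ?sqr_ge0.
- apply/measurable_EFinP; apply: measurable_funM.
    apply: measurable_funX; apply: measurable_funB.
      exact: (measurableT_comp (mgi i) measurable_snd).
    exact: (measurableT_comp (mgi i) measurable_fst).
  exact: (measurableT_comp (measurable_indic mX0) measurable_snd).
Qed.

(** The minimum is r_i p_i times the acceptance probability of the swap from i to i'; the proposal
    rate and the 1/2 of the Dirichlet form are left out. *)
Definition swap_energy (i i' : 'I_k.+2) : \bar R :=
  \int[mu]_(x in X0)
    (Num.min ((r i)%:num * p i x) ((r i')%:num * p i' x)
     * (g (i', x) - g (i, x)) ^+ 2)%:E.

(** The form of each M_i already contains its factor 1/2, whereas the swaps collect lam / 4 from the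
    1/2 of the form and the proposal rate lam / 2. *)
Lemma dirichlet_st_chain :
  dirichlet_on strip (st_law p r) (st_chain p r M lambda) g =
  (1 - lam)%:E *
    \sum_i (r i)%:num%:E * dirichlet_on X0 (law (p i)) (M i) (fun x => g (i, x))
  + (lam / 4)%:E * \sum_i \sum_(i' | adjacent i i') swap_energy i i'.
Proof.
have l0 : (0 <= lam)%R by [].
have l1 : (0 <= 1 - lam)%R by [].
pose a i i' x := st_accept p r (i, x) (i', x).
have mrp i : measurable_fun [set: X] (fun x => (r i)%:num * p i x)%R.
  by apply: measurable_funM => //; exact: measurable_dens.
have ma i i' : measurable_fun [set: X] (a i i').
  apply: measurable_accept => [||x]; [exact: mrp|exact: mrp|].
  by rewrite mulr_ge0 ?dens_ge0.
pose S i i' x := (a i i' x * (g (i', x) - g (i, x)) ^+ 2)%:E.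
have mS i i' : measurable_fun [set: X] (S i i').
  apply/measurable_EFinP; apply: measurable_funM => //.
  by apply: measurable_funX; exact: measurable_funB.
have S0 i i' x : 0 <= S i i' x by rewrite lee_fin mulr_ge0 ?accept0 ?sqr_ge0.
pose Q i x := \int[M i x]_(y in X0) ((g (i, y) - g (i, x)) ^+ 2)%:E.
have Q0 i x : 0 <= Q i x.
  by apply: integral_ge0 => y _; rewrite lee_fin sqr_ge0.
have mSS i : measurable_fun [set: X] (fun x => \sum_(i' | adjacent i i') S i i' x).
  under eq_fun do rewrite big_mkcond.
  by apply: emeasurable_sum => i'; case: (adjacent i i').
have SS0 i x : 0 <= \sum_(i' | adjacent i i') S i i' x by exact: sume_ge0.
pose J (z : state) :=
  (1 - lam)%:E * Q z.1 z.2 + (lam / 2)%:E * \sum_(i' | adjacent z.1 i') S z.1 i' z.2.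
have J1 i x : 0 <= (1 - lam)%:E * Q i x by apply: mule_ge0.
have J2 i x : 0 <= (lam / 2)%:E * \sum_(i' | adjacent i i') S i i' x.
  by apply: mule_ge0 => //; rewrite lee_fin divr_ge0.
have mJ1 i : measurable_fun [set: X] (fun x => (1 - lam)%:E * Q i x).
  by apply: measurable_funeM; exact: measurable_jump.
have mJ2 i : measurable_fun [set: X]
    (fun x => (lam / 2)%:E * \sum_(i' | adjacent i i') S i i' x).
  exact: measurable_funeM.
have JE z : strip z -> \int[st_chain p r M lambda z]_(z' in strip)
    ((g z' - g z) ^+ 2)%:E = J z.
  move=> [_ zX0]; rewrite integral_st_chain//.
  - case: z zX0 => i x zX0; rewrite /J/= /Q; congr (_ + _ * _).
  - apply/measurable_EFinP; apply: measurable_funX; exact: measurable_funB.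
  - by move=> z'; rewrite lee_fin sqr_ge0.
  - by rewrite subrr expr0n.
have step i : \int[law (p i)]_(x in X0) J (i, x) =
    (1 - lam)%:E * \int[law (p i)]_(x in X0) Q i x +
    (lam / 2)%:E * \sum_(i' | adjacent i i') \int[law (p i)]_(x in X0) S i i' x.
  rewrite /J/= ge0_integralD//; last 2 first.
  - exact: measurable_funTS.
  - exact: measurable_funTS.
  rewrite !ge0_integralZl_EFin//; last 2 first.
  - exact: measurable_funTS.
  - by apply: measurable_funTS; exact: measurable_jump.
  congr (_ + _ * _); rewrite [RHS]big_mkcond/=.
  under eq_integral do rewrite big_mkcond.
  rewrite ge0_integral_sum//.
  - by apply: eq_bigr => i' _; case: (adjacent i i') => //; rewrite integral0.
  - by move=> i'; case: (adjacent i i') => // _; exact: measurable_funTS.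
  - by move=> i' x _; case: (adjacent i i').
(* The density of level i times the acceptance probability is the minimum, by [accept_min]. *)
have swapE i i' : (r i)%:num%:E * \int[law (p i)]_(x in X0) S i i' x =
    swap_energy i i'.
  rewrite integral_law//; last exact: measurable_funTS.
  rewrite -ge0_integralZl_EFin//; last 2 first.
  - by move=> x _; apply: mule_ge0; rewrite ?lee_fin ?dens_ge0//; exact: S0.
  - apply: emeasurable_funM; first exact: measurable_EFin_dens.
    exact: measurable_funTS.
  apply: eq_integral => x _; rewrite -!EFinM; congr EFin; rewrite !mulrA.
  congr (_ * _)%R; rewrite /a /st_accept/=.
  set u := ((r i)%:num * p i x)%R; set v := ((r i')%:num * p i' x)%R.
  have u0 : (0 <= u)%R by rewrite mulr_ge0 ?dens_ge0.
  have v0 : (0 <= v)%R by rewrite mulr_ge0 ?dens_ge0.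
  by rewrite accept_min.
rewrite /dirichlet_on.
rewrite (eq_integral J); last by move=> z /set_mem; exact: JE.
rewrite integral_st_law//; last 2 first.
- by apply: measurable_fun_slices => i; exact: (emeasurable_funD (mJ1 i) (mJ2 i)).
- by move=> z; exact: (adde_ge0 (J1 _ _) (J2 _ _)).
under eq_bigr do rewrite xstrip step.
set A := fun i => (r i)%:num%:E * \int[law (p i)]_(x in X0) Q i x.
have iQ0 i : 0 <= \int[law (p i)]_(x in X0) Q i x.
  by apply: integral_ge0 => x _; exact: Q0.
have iS0 i i' : 0 <= \int[law (p i)]_(x in X0) S i i' x.
  by apply: integral_ge0 => x _; exact: S0.
have A0 i : 0 <= A i by apply: mule_ge0.
have E0 i i' : 0 <= swap_energy i i'.
  by apply: integral_ge0 => x _; rewrite lee_fin mulr_ge0 ?sqr_ge0// le_min !mulr_ge0 ?dens_ge0.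
rewrite (eq_bigr (fun i => (1 - lam)%:E * A i +
    (lam / 2)%:E * \sum_(i' | adjacent i i') swap_energy i i')); last first.
  move=> i _; rewrite ge0_muleDr; last 2 first.
  - exact: mule_ge0.
  - apply: mule_ge0; first by rewrite lee_fin divr_ge0.
    by apply: sume_ge0 => i' _; exact: iS0.
  rewrite !(muleCA (r i)%:num%:E); congr (_ + _ * _).
  rewrite ge0_sume_distrr => [|i' _]; last exact: iS0.
  by apply: eq_bigr => i' _; exact: swapE.
rewrite big_split/= -!ge0_sume_distrr//; last by move=> i _; exact: sume_ge0.
rewrite ge0_muleDr; last 2 first.
- by apply: mule_ge0 => //; exact: sume_ge0.
- apply: mule_ge0; first by rewrite lee_fin divr_ge0.
  by apply: sume_ge0 => i _; exact: sume_ge0.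
congr (_ + _).
- rewrite muleCA; congr (_ * _); rewrite ge0_sume_distrr//.
  by apply: eq_bigr => i _; rewrite /A muleCA.
- by rewrite muleA -EFinM; congr (_%:E * _); field.
Qed.
End tempering_dirichlet.

(** * Energy of the projected chain *)

Lemma fine_le_self (R : realDomainType) (x : \bar R) :
  (0 <= x -> (fine x)%:E <= x)%E.
Proof. by case: x => [x| |]//= _; rewrite leey. Qed.

Section projected_energy.
Local Open Scope ereal_scope.
Context d (X : measurableType d) (R : realType)
  (mu : {measure set X -> \bar R}) (k n : nat).
Variables (p : 'I_k.+2 -> density mu) (r : 'I_k.+2 -> {posnum R})
  (lambda : {itv R & `]0, 1[})
  (w : 'I_k.+2 -> 'I_n -> R) (pc : 'I_k.+2 -> 'I_n -> density mu)
  (X0 : set X) (g : 'I_k.+2 * X -> R).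
Hypotheses (mX0 : measurable X0) (w0 : forall i j, (0 <= w i j)%R)
  (pE : forall i x, p i x = (\sum_(j < n) w i j * pc i j x)%R)
  (pc0 : forall i j, 0 < law (pc i j) X0)
  (g2 : g \in Lfun (st_law p r) 2%:E).

Local Notation index := ('I_k.+2 * 'I_n)%type.
Local Notation strip := ([set: 'I_k.+2] `*` X0).
Local Notation lam := (lambda%:num).
Local Notation weight := (comp_weight r w).
Local Notation mass := (comp_mass pc X0).
Local Notation mean := (comp_mean pc X0 g).
Local Notation scatter := (comp_scatter pc X0 g).

(** The point comes first so that [u x] is the finite family to which [flow] applies; over j it sums
    to r_i p_i(x). *)
Definition comp_density (x : X) (a : index) : R := (weight a * pc a.1 a.2 x)%R.

Local Notation u := comp_density.

Let u0 x a : (0 <= u x a)%R.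
Proof. by rewrite mulr_ge0 ?comp_weight_ge0 ?dens_ge0. Qed.

Let sum_u x i : (\sum_j u x (i, j) = (r i)%:num * p i x)%R.
Proof.
by rewrite pE mulr_sumr; apply: eq_bigr => j _; rewrite /u /comp_weight/= mulrA.
Qed.

Let mu_ a : measurable_fun [set: X] (u ^~ a).
Proof. by apply: measurable_funM => //; exact: measurable_dens. Qed.

Let lam01 : (0 <= lam <= 1)%R.
Proof. by apply/andP; split. Qed.

Let measurable_inv (f : X -> R) : measurable_fun [set: X] f ->
  (forall x, (0 <= f x)%R) -> measurable_fun [set: X] (fun x => (f x)^-1)%R.
Proof.
move=> mf f0; under eq_fun do rewrite -powR_inv1//.
exact: (measurableT_comp (measurable_powR _)).
Qed.

Lemma measurable_flow a b :
  measurable_fun [set: X] (fun x => flow lam (u x) a b).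
Proof.
rewrite /flow; case: ((b.1 == a.1) && (b.2 != a.2)).
  apply: measurable_funM => //; apply: measurable_funM.
    by apply: measurable_funM; exact: mu_.
  apply: measurable_inv; last by move=> x; exact: sumr_ge0.
  by apply: measurable_sum => j; exact: mu_.
case: (adjacent a.1 b.1 && (b.2 == a.2)) => //.
apply: measurable_funM => //; by apply: measurable_minr; exact: mu_.
Qed.

(** The factor [mass a] cancels the normalisation of the component. Within a level the denominator
    r_i p_i is the sum of the u_j; for swaps [accept_min] produces the minimum. *)
Lemma proj_offdiag_le_flow a b :
  (weight a * mass a * proj_offdiag p r w pc lambda X0 a b)%:E
    <= \int[mu]_(x in X0) (flow lam (u x) a b)%:E.
Proof.
have mass0 := comp_mass_gt0 mX0 pc0.
have ma : mass a != 0%R by rewrite gt_eqF.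
have wm0 : (0 <= weight a * mass a)%R.
  by rewrite mulr_ge0 ?comp_weight_ge0// ltW.
(* No integrability is needed: [fine] maps +oo to 0, which only lowers the
   left-hand side. *)
have aux (s : R) (F : X -> R) : (0 <= s)%R -> measurable_fun [set: X] F ->
    (forall x, (0 <= F x)%R) ->
    (weight a * mass a * (s * \int[mu]_(x in X0) F x))%:E <=
    \int[mu]_(x in X0) (weight a * mass a * s * F x)%:E.
  move=> s0 mF F0; rewrite mulrA EFinM.
  have k0 : (0 <= weight a * mass a * s)%R by exact: mulr_ge0.
  under eq_integral do rewrite EFinM.
  rewrite ge0_integralZl_EFin//; last 2 first.
  - by move=> x _; rewrite lee_fin.
  - by apply/measurable_EFinP; exact: measurable_funTS.
  rewrite lee_wpmul2l ?lee_fin//.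
  by apply: fine_le_self; apply: integral_ge0 => x _; rewrite lee_fin.
have mpcm : measurable_fun [set: X] (fun x => pc a.1 a.2 x / mass a)%R.
  by apply: measurable_funM => //; exact: measurable_dens.
rewrite /proj_offdiag /flow; case: ifP => [/andP[/eqP ba _]|_].
  apply: (le_trans (aux (1 - lam)%R (fun x =>
      pc a.1 a.2 x / mass a * cond_comp p w pc a.1 b.2 x)%R _ _ _)).
  - by move: lam01; rewrite subr_ge0 => /andP[].
  - apply: measurable_funM => //; apply: measurable_funM.
      by apply: measurable_funM => //; exact: measurable_dens.
    apply: measurable_inv; [exact: measurable_dens|exact: dens_ge0].
  - by move=> x; rewrite /cond_comp !(mulr_ge0, divr_ge0, dens_ge0)// ?invr_ge0 ?dens_ge0 ?ltW.
  - rewrite le_eqVlt; apply/orP; left; apply/eqP.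
    apply: eq_integral => x _; congr EFin; rewrite sum_u.
    rewrite /cond_comp /u /comp_weight ba.
    have rN : (r a.1)%:num != 0%R :> R by [].
    (* p_i(x) may vanish, so its inverse is kept opaque and [field] divides only by r_i and the
       mass. *)
    rewrite invfM; set y := (p a.1 x)^-1%R.
    move: (mass a) ma (r a.1)%:num rN => m mN s sN.
    by field; rewrite sN.
rewrite /adjacent; case: ifP => _; last by rewrite mulr0 integral0.
apply: (le_trans (aux (lam / 2)%R (fun x =>
    pc a.1 a.2 x / mass a * comp_accept r w pc a b x)%R _ _ _)).
- by rewrite divr_ge0.
- apply: measurable_funM => //.
  apply: measurable_accept => [||x]; first exact: mu_.
    exact: mu_.
  exact: u0.
- move=> x; apply: mulr_ge0.
    by apply: divr_ge0; [exact: dens_ge0|exact: ltW].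
  exact: (accept_ge0 (u0 x b) (u0 x a)).
- rewrite le_eqVlt; apply/orP; left; apply/eqP.
  apply: eq_integral => x _; congr EFin.
  rewrite -(accept_min (u0 x b) (u0 x a)) /comp_accept -/(u x b) -/(u x a).
  by rewrite /u; field.
Qed.

(** [flow_energy_le] is integrated over X0 with y_i = g(i, x) and c the component means. The left
    side is 2 theta times the projected Dirichlet form at these means. *)
Lemma proj_energy_le :
  (\sum_a \sum_b (mean b - mean a) ^+ 2
     * (weight a * mass a * proj_chain p r w pc lambda X0 a b))%:E
  <= (2 * (2 + lam) * \sum_a weight a * scatter a)%:E
     + (3 * (lam / 2))%:E *
       \sum_i \sum_(i' | adjacent i i') swap_energy p r X0 g i i'.
Proof.
have mgi := measurable_level g2.
have /andP[l0 l1] := lam01.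
pose F x := (\sum_a \sum_b (mean b - mean a) ^+ 2 * flow lam (u x) a b)%R.
have Fab0 a b x : (0 <= (mean b - mean a) ^+ 2 * flow lam (u x) a b)%R.
  by rewrite mulr_ge0 ?sqr_ge0// flow_ge0.
have mFab a b : measurable_fun X0
    (fun x => ((mean b - mean a) ^+ 2 * flow lam (u x) a b)%:E).
  apply/measurable_EFinP/measurable_funTS; apply: measurable_funM => //.
  exact: measurable_flow.
have intF : \int[mu]_(x in X0) (F x)%:E = \sum_a \sum_b
    \int[mu]_(x in X0) ((mean b - mean a) ^+ 2 * flow lam (u x) a b)%:E.
  rewrite /F; under eq_integral do rewrite -sumEFin.
  rewrite ge0_integral_sum//; last 2 first.
  - move=> a; under eq_fun do rewrite -sumEFin.
    exact: emeasurable_sum.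
  - by move=> a x _; rewrite lee_fin sumr_ge0.
  apply: eq_bigr => a _; under eq_integral do rewrite -sumEFin.
  by rewrite ge0_integral_sum// => b x _; rewrite lee_fin.
apply: (@le_trans _ _ (\int[mu]_(x in X0) (F x)%:E)).
  rewrite intF -sumEFin; apply: lee_sum => a _.
  rewrite -sumEFin; apply: lee_sum => b _.
  (* The diagonal entries of the projected chain meet a vanishing square. *)
  have [->|ba] := eqVneq b a.
    rewrite subrr expr0n mul0r; apply: integral_ge0 => x _.
    by rewrite mul0r.
  rewrite /proj_chain (negPf ba) EFinM.
  under eq_integral do rewrite EFinM.
  rewrite ge0_integralZl_EFin ?sqr_ge0//; last 2 first.
  - by move=> x _; rewrite lee_fin flow_ge0.
  - by apply/measurable_EFinP/measurable_funTS; exact: measurable_flow.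
  by rewrite lee_wpmul2l ?lee_fin ?sqr_ge0//; exact: proj_offdiag_le_flow.
(* A and B are the two sums on the right of [flow_energy_le]; they integrate to the weighted
   scatters and to the swap energies. *)
pose A x := (\sum_a u x a * (g (a.1, x) - mean a) ^+ 2)%R.
pose B x := (\sum_i \sum_(i' | adjacent i i')
  Num.min ((r i)%:num * p i x) ((r i')%:num * p i' x) * (g (i', x) - g (i, x)) ^+ 2)%R.
have mAa a : measurable_fun X0 (fun x => (u x a * (g (a.1, x) - mean a) ^+ 2)%:E).
  apply/measurable_EFinP/measurable_funTS; apply: measurable_funM; first exact: mu_.
  by apply: measurable_funX; apply: measurable_funB.
have Aa0 a x : (0 <= u x a * (g (a.1, x) - mean a) ^+ 2)%R.
  by rewrite mulr_ge0 ?sqr_ge0.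
have mrp i : measurable_fun [set: X] (fun x => (r i)%:num * p i x)%R.
  by apply: measurable_funM => //; exact: measurable_dens.
have mBii i i' : measurable_fun X0 (fun x =>
    (Num.min ((r i)%:num * p i x) ((r i')%:num * p i' x)
     * (g (i', x) - g (i, x)) ^+ 2)%:E).
  apply/measurable_EFinP/measurable_funTS; apply: measurable_funM.
    by apply: measurable_minr; exact: mrp.
  by apply: measurable_funX; exact: measurable_funB.
have Bii0 i i' x : (0 <= Num.min ((r i)%:num * p i x) ((r i')%:num * p i' x)
     * (g (i', x) - g (i, x)) ^+ 2)%R.
  by rewrite mulr_ge0 ?sqr_ge0// le_min !mulr_ge0 ?dens_ge0.
have mA : measurable_fun X0 (fun x => (A x)%:E).
  by rewrite /A; under eq_fun do rewrite -sumEFin; exact: emeasurable_sum.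
have mBi i : measurable_fun X0 (fun x => (\sum_(i' | adjacent i i')
  Num.min ((r i)%:num * p i x) ((r i')%:num * p i' x) * (g (i', x) - g (i, x)) ^+ 2)%:E).
  under eq_fun do rewrite -sumEFin big_mkcond.
  by apply: emeasurable_sum => i'; case: (adjacent i i').
have mB : measurable_fun X0 (fun x => (B x)%:E).
  by rewrite /B; under eq_fun do rewrite -sumEFin; exact: emeasurable_sum.
have A0 x : (0 <= A x)%R by exact: sumr_ge0.
have Bi0 i x : (0 <= \sum_(i' | adjacent i i')
  Num.min ((r i)%:num * p i x) ((r i')%:num * p i' x) * (g (i', x) - g (i, x)) ^+ 2)%R.
  exact: sumr_ge0.
have B0 x : (0 <= B x)%R by apply: sumr_ge0 => i _; exact: Bi0.
have intA : \int[mu]_(x in X0) (A x)%:E = (\sum_a weight a * scatter a)%:E.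
  rewrite /A; under eq_integral do rewrite -sumEFin.
  rewrite ge0_integral_sum// -?sumEFin; last by move=> a x _; rewrite lee_fin.
  apply: eq_bigr => a _.
  (* Centring at the component's own mean removes the mean discrepancy from
     [integral_comp_affine]. *)
  have -> : (weight a * scatter a)%:E = (weight a)%:E *
      \int[law (pc a.1 a.2)]_(x in X0) (0 + 1 * (mean a - g (a.1, x)) ^+ 2)%:E.
    rewrite (integral_comp_affine mX0 w0 pE pc0 g2)//.
    by rewrite mul0r add0r mul1r subrr expr0n mulr0 addr0.
  have sq x : (0 + 1 * (mean a - g (a.1, x)) ^+ 2 = (g (a.1, x) - mean a) ^+ 2)%R.
    by ring.
  under [in RHS]eq_integral do rewrite sq.
  rewrite integral_law//; last 2 first.
  - apply/measurable_EFinP/measurable_funTS.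
    by apply: measurable_funX; exact: measurable_funB.
  - by move=> x _; rewrite lee_fin sqr_ge0.
  rewrite -ge0_integralZl_EFin ?comp_weight_ge0//; last 2 first.
  - by move=> x _; apply: mule_ge0; rewrite lee_fin ?dens_ge0 ?sqr_ge0.
  - apply: emeasurable_funM; first exact: measurable_EFin_dens.
    apply/measurable_EFinP/measurable_funTS.
    by apply: measurable_funX; exact: measurable_funB.
  by apply: eq_integral => x _; rewrite /u -!EFinM mulrA.
have intB : \int[mu]_(x in X0) (B x)%:E =
    \sum_i \sum_(i' | adjacent i i') swap_energy p r X0 g i i'.
  rewrite /B; under eq_integral do rewrite -sumEFin.
  rewrite ge0_integral_sum//; last by move=> i x _; rewrite lee_fin Bi0.
  apply: eq_bigr => i _; under eq_integral do rewrite -sumEFin big_mkcond.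
  rewrite [RHS]big_mkcond ge0_integral_sum//.
  - by apply: eq_bigr => i' _; case: (adjacent i i') => //; rewrite integral0.
  - by move=> i'; case: (adjacent i i').
  - by move=> i' x _; case: (adjacent i i') => //; rewrite lee_fin.
rewrite EFinM -intA -intB.
have c10 : (0 <= 2 * (2 + lam))%R by rewrite mulr_ge0 ?addr_ge0.
have c20 : (0 <= 3 * (lam / 2))%R by rewrite mulr_ge0 ?divr_ge0.
rewrite -!ge0_integralZl_EFin//; last 2 first.
- by move=> x _; rewrite lee_fin.
- by move=> x _; rewrite lee_fin.
rewrite -ge0_integralD//; last 4 first.
- by move=> x _; rewrite mule_ge0 ?lee_fin.
- exact: measurable_funeM.
- by move=> x _; rewrite mule_ge0 ?lee_fin.
- exact: measurable_funeM.
apply: ge0_le_integral => //.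
- by move=> x _; rewrite lee_fin; apply: sumr_ge0 => a _; exact: sumr_ge0.
- rewrite /F; under eq_fun do rewrite -sumEFin.
  apply: emeasurable_sum => a; under eq_fun do rewrite -sumEFin.
  exact: emeasurable_sum.
- by apply: emeasurable_funD; exact: measurable_funeM.
move=> x _; rewrite -!EFinM -EFinD lee_fin.
have := @flow_energy_le R k n lam (u x) mean (fun i => g (i, x)) lam01 (u0 x).
rewrite /A /B.
by under [X in _ -> (_ <= _ + _ * X)%R]eq_bigr do
  under eq_bigr do rewrite -!sum_u.
Qed.

End projected_energy.

(** * Spectral gap *)

(** Eliminating vb and eb gives V <= theta ((2 + lam) C3 + 1) T + 3 theta C3 (lam / 4) e. Bounding T
    by C1 C2 s / phi leaves one coefficient for (1 - lam) s and one for (lam / 4) e, and CM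
    dominates both. Here T is the total weighted scatter, and s and e are the level and swap parts
    of the energy. *)
Lemma spec_gap_arith (R : realFieldType)
    (theta phi lam C1 C2 C3 V T vb eb s e CM : R) :
  0 < theta -> 0 < phi -> 0 < lam -> lam < 1 -> 0 < C3 -> 0 <= C1 -> 0 <= C2 ->
  0 <= s -> 0 <= e ->
  V = theta * T + theta ^+ 2 * vb ->
  vb <= C3 * eb ->
  2 * (theta * eb) <= 2 * (2 + lam) * T + 3 * (lam / 2) * e ->
  phi * T <= C1 * C2 * s ->
  3 * theta * C3 <= CM ->
  theta * C1 * C2 / (phi * (1 - lam)) * ((2 + lam) * C3 + 1) <= CM ->
  V <= CM * ((1 - lam) * s + lam / 4 * e).
Proof.
move=> th0 ph0 l0 l1 C30 C10 C20 s0 e0 -> vbP ebP TP CM1 CM2.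
have l1' : 0 < 1 - lam by rewrite subr_gt0.
set K := (2 + lam) * C3 + 1 in CM2 *.
have K0 : 0 < K by rewrite addr_gt0 ?mulr_gt0 ?addr_gt0.
have step1 : theta * T + theta ^+ 2 * vb <=
    theta * K * T + 3 * theta * C3 * (lam / 4 * e).
  have h1 : theta ^+ 2 * vb <= theta ^+ 2 * (C3 * eb).
    by rewrite ler_wpM2l ?sqr_ge0.
  have h2 : theta * C3 * (2 * (theta * eb)) <=
      theta * C3 * (2 * (2 + lam) * T + 3 * (lam / 2) * e).
    by rewrite ler_wpM2l// ltW// mulr_gt0.
  by rewrite /K; nra.
have step2 : theta * K * T <=
    theta * C1 * C2 / (phi * (1 - lam)) * K * ((1 - lam) * s).
  have -> : theta * C1 * C2 / (phi * (1 - lam)) * K * ((1 - lam) * s) =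
      theta * K * (C1 * C2 * s / phi).
    by field; rewrite !gt_eqF.
  rewrite ler_wpM2l ?ler_pdivlMr//; first by rewrite ltW// mulr_gt0.
  by rewrite mulrC.
apply: (le_trans step1); rewrite [leRHS]mulrDr; apply: lerD.
  by apply: (le_trans step2); rewrite ler_wpM2r// mulr_ge0// ltW.
by rewrite ler_wpM2r// mulr_ge0// divr_ge0// ltW.
Qed.

Lemma dirichlet_on_ge0 d (X : measurableType d) (R : realType) (O : set X)
    (nu : {measure set X -> \bar R}) (K : R.-pker X ~> X) (g : X -> R) :
  (0 <= dirichlet_on O nu K g)%E.
Proof.
apply: mule_ge0; first by rewrite lee_fin.
apply: integral_ge0 => x _; apply: integral_ge0 => y _.
by rewrite lee_fin sqr_ge0.
Qed.

Theorem theorem2 (R : realType) (d : measure_display) (X : measurableType d)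
    (mu : {measure set X -> \bar R}) (k n : nat)
    (p : 'I_k.+2 -> density mu) (r : 'I_k.+2 -> {posnum R})
    (M : 'I_k.+2 -> R.-pker X ~> X) (lambda : {itv R & `]0, 1[})
    (w : 'I_k.+2 -> 'I_n -> R) (pc : 'I_k.+2 -> 'I_n -> density mu)
    (Mc : 'I_k.+2 -> 'I_n -> R.-pker X ~> X)
    (X0 : set X) (C1 C2 C3 : R)
    (hr : \sum_(i < k.+2) (r i)%:num = 1)
    (hM : forall i, stationary (law (p i)) (M i))
    (hX0 : measurable X0)
    (hw0 : forall i j, 0 <= w i j)
    (hw1 : forall i, \sum_(j < n) w i j = 1)
    (hp : forall i x, p i x = \sum_(j < n) w i j * pc i j x)
    (hpc : forall i j, (0 < law (pc i j) X0)%E)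
    (hMc : forall i j, stationary (law (pc i j)) (Mc i j))
    (hC1 : 0 < C1) (hC2 : 0 < C2) (hC3 : 0 < C3)
    (hdecomp : forall i (g : X -> R), g \in Lfun (law (p i)) 2%:E ->
      (\sum_(j < n) (w i j)%:E * dirichlet_on X0 (law (pc i j)) (Mc i j) g
        <= C1%:E * dirichlet_on X0 (law (p i)) (M i) g)%E)
    (hlocal : forall i (g : X -> R), g \in Lfun (law (p i)) 2%:E ->
      forall j, (variance_on X0 (law (pc i j)) g
        <= C2%:E * dirichlet_on X0 (law (pc i j)) (Mc i j) g)%E)
    (hproj : forall g : 'I_k.+2 * 'I_n -> R,
      fin_variance (proj_law p r w pc X0) g
        <= C3 * fin_dirichlet (proj_law p r w pc X0)
                  (proj_chain p r w pc lambda X0) g) :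
  let theta := fine (st_law p r ([set: 'I_k.+2] `*` X0)) in
  (* the masses are at most 1, so the default value 1 does not affect phi *)
  let phi := \big[Num.min/1]_(i < k.+2) \big[Num.min/1]_(j < n)
               fine (law (pc i j) X0) in
  let CM := Num.max (3 * theta * C3)
              (theta * C1 * C2 / (phi * (1 - lambda%:num))
                * ((2 + lambda%:num) * C3 + 1)) in
  (CM^-1%:E <= spec_gap_on ([set: 'I_k.+2] `*` X0) (st_law p r)
                 (st_chain p r M lambda))%E.
Proof.
pose theta := fine (st_law p r ([set: 'I_k.+2] `*` X0)).
pose phi := \big[Num.min/1]_(i < k.+2) \big[Num.min/1]_(j < n)
  fine (law (pc i j) X0).
have l0 : 0 < lambda%:num by [].
have l1 : lambda%:num < 1 by [].
set lam := lambda%:num in l0 l1 *.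
pose CM := Num.max (3 * theta * C3)
  (theta * C1 * C2 / (phi * (1 - lam)) * ((2 + lam) * C3 + 1)).
change (CM^-1%:E <= spec_gap_on ([set: 'I_k.+2] `*` X0) (st_law p r)
  (st_chain p r M lambda))%E.
pose mass := comp_mass pc X0.
pose weight := comp_weight r w.
have mass0 a : 0 < mass a by exact: comp_mass_gt0.
have weight0 a : 0 <= weight a by exact: comp_weight_ge0.
have thetaE : theta = \sum_a weight a * mass a.
  by rewrite /theta (st_law_strip r hX0 hw0 hp).
have phi0 : 0 < phi.
  apply: lt_bigmin => // i _; apply: lt_bigmin => // j _.
  exact: (mass0 (i, j)).
have phi_le a : phi <= mass a.
  exact: le_trans (bigmin_le _ a.1 _) (bigmin_le _ a.2 _).
have theta0 : 0 < theta.
  apply: (@lt_le_trans _ _ phi); first exact: phi0.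
  (* The weights r_i w_(i,j) sum to 1, so theta is an average of masses that are at least phi. *)
  have -> : phi = \sum_a weight a * phi.
    rewrite -mulr_suml -(pair_bigA _ (fun i j => weight (i, j)))/=.
    rewrite (eq_bigr (fun i => (r i)%:num)) => [|i _]; first by rewrite hr mul1r.
    by rewrite /weight /comp_weight/= -mulr_sumr hw1 mulr1.
  by rewrite thetaE; apply: ler_sum => a _; exact: ler_wpM2l.
have CM0 : 0 < CM.
  by rewrite lt_max; apply/orP; left; apply: mulr_gt0 => //; exact: mulr_gt0.
apply: le_ereal_inf_tmp => _ [g [g2 var0] <-].
have mg := measurable_Lfun g2.
have gi2 i : (fun x => g (i, x)) \in Lfun (law (p i)) 2%:E.
  apply: sqr_integrable_Lfun2; last exact: Lfun_st_law g2.
  exact: measurable_level g2 i.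
pose c := comp_mean pc X0 g.
pose v := comp_scatter pc X0 g.
have v0 a : 0 <= v a by exact: scatter_on_ge0.
have VE := variance_st_law hX0 hw0 hp hpc g2.
rewrite -/mass -/weight -/c -/v -thetaE in VE.
set T := \sum_a weight a * v a in VE.
pose D i := dirichlet_on X0 (law (p i)) (M i) (fun x => g (i, x)).
pose s := (\sum_i (r i)%:num%:E * D i)%E.
pose e := (\sum_i \sum_(i' | adjacent i i') swap_energy p r X0 g i i')%E.
have D0 i : (0 <= D i)%E.
  exact: dirichlet_on_ge0.
have s0 : (0 <= s)%E by apply: sume_ge0 => i _; apply: mule_ge0.
have e0 : (0 <= e)%E.
  apply: sume_ge0 => i _; apply: sume_ge0 => i' _; apply: integral_ge0 => x _.
  by rewrite lee_fin mulr_ge0 ?sqr_ge0// le_min !mulr_ge0 ?dens_ge0.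
have EE : dirichlet_on ([set: 'I_k.+2] `*` X0) (st_law p r) (st_chain p r M lambda) g
    = ((1 - lam)%:E * s + (lam / 4)%:E * e)%E.
  exact: dirichlet_st_chain.
(* The local variance is mass times scatter, hence at least phi times scatter. The local Poincare
   inequalities give C2, and the comparison of Dirichlet forms then gives C1. *)
have TP : ((phi * T)%:E <= (C1 * C2)%:E * s)%E.
  have comp_le a : ((phi * (weight a * v a))%:E <= (weight a)%:E *
      (C2%:E * dirichlet_on X0 (law (pc a.1 a.2)) (Mc a.1 a.2) (fun x => g (a.1, x))))%E.
    have := hw0 a.1 a.2; rewrite le_eqVlt => /predU1P[wa|wa].
      by rewrite /weight /comp_weight -wa mulr0 mul0r mulr0 mul0e.
    apply: (@le_trans _ _ ((weight a)%:E * (mass a * v a)%:E)%E).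
      rewrite -EFinM lee_fin mulrCA; apply: ler_wpM2l => //.
      exact: ler_wpM2r.
    rewrite lee_wpmul2l ?lee_fin//.
    have <- : variance_on X0 (law (pc a.1 a.2)) (fun x => g (a.1, x)) =
        (mass a * v a)%:E.
      apply: variance_onE => //; first exact: hpc.
        exact: measurable_level g2 a.1.
      exact: (comp_sqr_integrable hw0 hp g2).
    exact: hlocal.
  have -> : (phi * T)%:E = (\sum_a (phi * (weight a * v a))%:E)%E.
    by rewrite /T mulr_sumr sumEFin.
  apply: le_trans (lee_sum _ (fun a _ => comp_le a)) _.
  rewrite -(pair_bigA _ (fun i j => (weight (i, j))%:E * (C2%:E *
    dirichlet_on X0 (law (pc i j)) (Mc i j) (fun x => g (i, x))))%E)/=.
  rewrite /s ge0_sume_distrr => [|i _]; last exact: mule_ge0.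
  apply: lee_sum => i _.
  apply: (@le_trans _ _ (((r i)%:num * C2)%:E * (\sum_(j < n) (w i j)%:E *
      dirichlet_on X0 (law (pc i j)) (Mc i j) (fun x => g (i, x))))%E).
    rewrite ge0_sume_distrr => [|j _]; last first.
      apply: mule_ge0; first by rewrite lee_fin.
      exact: dirichlet_on_ge0.
    apply: lee_sum => j _; rewrite /weight /comp_weight/=.
    move: (dirichlet_on _ _ _ _) => E; rewrite !muleA -!EFinM.
    by rewrite [X in (X%:E * _ <= _)%E]mulrAC.
  have -> : ((C1 * C2)%:E * ((r i)%:num%:E * D i) =
      ((r i)%:num * C2)%:E * (C1%:E * D i))%E.
    by move: (D i) => E; rewrite !muleA -!EFinM; congr (_%:E * _)%E; ring.
  rewrite lee_wpmul2l//; first by rewrite lee_fin mulr_ge0// ltW.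
  exact: (hdecomp i _ (gi2 i)).
have eE := proj_energy_le lambda hX0 hw0 hp hpc g2.
rewrite -/mass -/weight -/c -/v -/T -/e -/lam in eE.
set V := (X in X%:E) in VE; rewrite VE lte_fin in var0.
rewrite EE VE inver gt_eqF// lee_pdivlMr//.
pose vb := fin_variance (proj_law p r w pc X0) c.
pose eb := fin_dirichlet (proj_law p r w pc X0) (proj_chain p r w pc lambda X0) c.
(* theta is the normalising constant of Pbar. *)
have projE a : theta * proj_law p r w pc X0 a = weight a * mass a.
  by rewrite /proj_law -/theta mulrC divfK// gt_eqF.
have VbE : V = theta * T + theta ^+ 2 * vb.
  rewrite /V /vb /fin_variance; congr (_ + _).
  rewrite mulrCA; congr (_ * _); rewrite mulr_sumr; apply: eq_bigr => a _.
  rewrite mulr_sumr; apply: eq_bigr => b _; rewrite -!projE; ring.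
have ebE : 2 * (theta * eb) = \sum_a \sum_b (c b - c a) ^+ 2 *
    (weight a * mass a * proj_chain p r w pc lambda X0 a b).
  rewrite /eb /fin_dirichlet; set S := (X in 2^-1 * X).
  have -> : 2 * (theta * (2^-1 * S)) = theta * S by field.
  rewrite /S mulr_sumr; apply: eq_bigr => a _.
  rewrite mulr_sumr; apply: eq_bigr => b _; rewrite -projE; ring.
rewrite -ebE in eE.
have lam40 : 0 < lam / 4 by rewrite divr_gt0.
have l1' : 0 < 1 - lam by rewrite subr_gt0.
(* If s or e is infinite, so is the Dirichlet form and the bound is trivial; otherwise everything is
   real arithmetic. *)
clear EE; clearbody s e; move: s0 e0 TP eE; case: s => [s| |]//; last first.
  move=> _ e0 _ _; rewrite gt0_muley ?lte_fin// addye ?leey//.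
  by rewrite gt_eqF// (lt_le_trans (ltNyr 0))// mule_ge0// lee_fin ltW.
case: e => [e| |]//; last first.
  by move=> _ _ _ _; rewrite (gt0_muley (_ : 0 < _)%E) ?lte_fin// addey ?leey.
rewrite -!EFinM -!EFinD !lee_fin => s0 e0 TP eE.
rewrite mulrC ler_pdivrMr// mulrC.
apply: (spec_gap_arith theta0 phi0 l0 l1 hC3 (ltW hC1) (ltW hC2) s0 e0 VbE
  (hproj c) eE TP); first by rewrite le_max lexx.
by rewrite le_max lexx orbT.
Qed.
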